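(* Let $(\mathbb{X},\mathbb{T})$ be a tangent category. Tangent fibrations on $(\mathbb{X},\mathbb{T})$, i.e. with base tangent category $(\mathbb{X},\mathbb{T})$, are precisely the pseudoalgebras of the $2$-monad $$M\colon\mathsf{TngCat}_{\cong}/(\mathbb{X},\mathbb{T})\to\mathsf{TngCat}_{\cong}/(\mathbb{X},\mathbb{T}),\qquad (\Pi,\alpha)\mapsto\bigl((\mathbb{X},\mathbb{T})\downarrow(\Pi,\alpha)\to(\mathbb{X},\mathbb{T})\bigr),$$ whose underlying tangent morphism $(\Pi,\alpha)$ is strict.
   Context: **Tangent categories.** An additive bundle is a morphism $q\colon E\to B$ whose $n$-fold pullbacks $E_n$ along itself exist, with $z_q\colon B\to E$, $s_q\colon E_2\to E$ making it a commutative monoid in the slice over $B$; a morphism $(f,g)$ satisfies $q'g=fq$, $gz_q=z_q'f$, $gs_q=s_q'(g\times_fg)$. A tangent category $(\mathbb{X},\mathbb{T})$ is a category with an endofunctor $\mathrm{T}$ and natural transformations $p\colon\mathrm{T}\Rightarrow\mathrm{id}$, whose $n$-fold pullbacks $\mathrm{T}_n$ along itself exist with projections $\pi_k$ and are preserved by all $\mathrm{T}^m$, $z\colon\mathrm{id}\Rightarrow\mathrm{T}$, $s\colon\mathrm{T}_2\Rightarrow\mathrm{T}$, $l\colon\mathrm{T}\Rightarrow\mathrm{T}^2$, $c\colon\mathrm{T}^2\Rightarrow\mathrm{T}^2$ such that: $(A,\mathrm{T}A,p,z,s)$ is an additive bundle; $(z,l)\colon(A,\mathrm{T}A,p,z,s)\to(\mathrm{T}A,\mathrm{T}^2A,\mathrm{T}p,\mathrm{T}z,\mathrm{T}s)$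 and $(\mathrm{id},c)\colon(\mathrm{T}A,\mathrm{T}^2A,\mathrm{T}p,\mathrm{T}z,\mathrm{T}s)\to(\mathrm{T}A,\mathrm{T}^2A,p_{\mathrm{T}},z_{\mathrm{T}},s_{\mathrm{T}})$ are additive bundle morphisms; $\mathrm{T}l\circ l=l_{\mathrm{T}}\circ l$; $c^2=\mathrm{id}$; $\mathrm{T}c\circ c_{\mathrm{T}}\circ\mathrm{T}c=c_{\mathrm{T}}\circ\mathrm{T}c\circ c_{\mathrm{T}}$; $c\circ l=l$; $\mathrm{T}l\circ c=c_{\mathrm{T}}\circ\mathrm{T}c\circ l_{\mathrm{T}}$; and $\phi=\mathrm{T}s\circ\langle l\pi_1,z_{\mathrm{T}}\pi_2\rangle\colon\mathrm{T}_2A\to\mathrm{T}^2A$ and $p\pi_1\colon\mathrm{T}_2A\to A$ exhibit $\mathrm{T}_2A$ as the pullback of $\mathrm{T}p\colon\mathrm{T}^2A\to\mathrm{T}A$ along $z\colon A\to\mathrm{T}A$. A strong tangent morphism $(F,\alpha)\colon(\mathbb{X},\mathbb{T})\to(\mathbb{X}',\mathbb{T}')$ is a functor $F$ with a natural isomorphism $\alpha\colon F\mathrm{T}\Rightarrow\mathrm{T}'F$ such that $(\mathrm{id},\alpha)\colon(FA,F\mathrm{T}A,Fp,Fz,Fs)\to(FA,\mathrm{T}'FA,p'_F,z'_F,s'_F)$ is additive, $\mathrm{T}'\alpha\circ\alpha_{\mathrm{T}}\circ Fl=l'_F\circ\alpha$, $c'_F\circ\mathrm{T}'\alpha\circ\alpha_{\mathrm{T}}=\mathrm{T}'\alpha\circ\alpha_{\mathrm{T}}\circ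 Fc$, and $F$ preserves the $n$-fold pullbacks of $p$ along itself and the vertical lift pullback; it is strict if $\alpha=\mathrm{id}$. A tangent natural transformation $\theta\colon(F,\alpha)\Rightarrow(G,\beta)$ is a natural transformation with $\mathrm{T}'\theta\circ\alpha=\beta\circ\theta_{\mathrm{T}}$. $\mathsf{TngCat}_{\cong}$ is the resulting $2$-category, and $\mathsf{TngCat}_{\cong}/(\mathbb{X},\mathbb{T})$ is its slice $2$-category. **Tangent fibrations.** A morphism $\varphi\colon\tilde E\to E'$ of $\mathbb{X}'$ is cartesian for a functor $\Pi\colon\mathbb{X}'\to\mathbb{X}$ if, with $f=\Pi\varphi\colon\tilde A\to A'$, for every $\psi\colon E\to E'$ and every $h\colon\Pi E\to\tilde A$ with $f\circ h=\Pi\psi$ there is a unique $\xi\colon E\to\tilde E$ with $\Pi\xi=h$ and $\varphi\xi=\psi$. A cloven fibration is a functor $\Pi$ with a chosen cartesian lift $\varphi^{(f)}\colon f^*E'\to E'$ of $f$ for each $f\colon A\to A'$ and each $E'$ with $\Pi E'=A'$. A tangent fibration $\Pi\colon(\mathbb{X}',\mathbb{T}')\to(\mathbb{X},\mathbb{T})$ is a cloven fibration whose underlying functor is a strict tangent morphism and such that for all $f$, $E'$ the unique morphism $\kappa^{(f)}\colon\mathrm{T}'(f^*E')\to(\mathrm{T}f)^*(\mathrm{T}'E')$ over the identity with $\varphi^{(\mathrm{T}f)}\circ\kappa^{(f)}=\mathrm{T}'\varphi^{(f)}$ is an isomorphism. **The $2$-monad $M$.** For a strong tangent morphism $(\Pi,\alpha)\colon(\mathbb{X}',\mathbb{T}')\to(\mathbb{X},\mathbb{T})$,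 $(\mathbb{X},\mathbb{T})\downarrow(\Pi,\alpha)$ is the comma category $\mathbb{X}\downarrow\Pi$ (objects: $A\in\mathbb{X}$, $E\in\mathbb{X}'$ and $f\colon A\to\Pi E$) with the tangent structure, induced by those of $(\mathbb{X},\mathbb{T})$ and $(\mathbb{X}',\mathbb{T}')$, whose tangent bundle functor sends $f\colon A\to\Pi E$ to $\mathrm{T}A\xrightarrow{\mathrm{T}f}\mathrm{T}\Pi E\xrightarrow{\alpha^{-1}}\Pi\mathrm{T}'E$; the projection to $(\mathbb{X},\mathbb{T})$ sends $f\colon A\to\Pi E$ to $A$ and is a strict tangent morphism. This is the comma object in $\mathsf{TngCat}_{\cong}$ of the identity of $(\mathbb{X},\mathbb{T})$ and $(\Pi,\alpha)$. The unit of $M$ sends $E$ to $\mathrm{id}\colon\Pi E\to\Pi E$, and the multiplication is given by composition: it sends $(B\xrightarrow{g}A,\ A\xrightarrow{f}\Pi E)$ to $f\circ g\colon B\to\Pi E$. This is the analogue in $\mathsf{TngCat}_{\cong}$ of Street's $2$-monad on $\mathsf{Cat}/\mathbb{X}$ sending $\Pi$ to $\mathbb{X}\downarrow\Pi\to\mathbb{X}$, whose pseudoalgebras are cloven fibrations. **Pseudoalgebras.** A pseudoalgebra of a $2$-monad $(M,\eta,\gamma)$ on a $2$-category is an object $A$ with a $1$-morphism $a\colon MA\to A$ and invertible $2$-morphisms $\zeta\colon\mathrm{id}_A\Rightarrow a\circ\eta$ and $\theta\colon a\circ Ma\Rightarrow a\circ\gamma$ satisfying the usual unit and associativity coherence conditions.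 *)

(* Defs.v *)
From Corelib Require Import ssreflect.
From Stdlib Require Import FunctionalExtensionality ProofIrrelevance Description.
From Stdlib Require Fin.
Set Implicit Arguments.
Unset Strict Implicit.
Unset Printing Implicit Defensive.
Set Primitive Projections.
Set Bullet Behavior "None".

Declare Scope cat_scope.
Open Scope cat_scope.

Record Cat := {
  ob :> Type;
  hom : ob -> ob -> Type;
  idc : forall A, hom A A;
  comp : forall A B C, hom B C -> hom A B -> hom A C;
  comp1f : forall A B (f : hom A B), comp (idc B) f = f;
  compf1 : forall A B (f : hom A B), comp f (idc A) = f;
  compA : forall A B C D (h : hom C D) (g : hom B C) (f : hom A B),
    comp h (comp g f) = comp (comp h g) f
}.
Arguments hom {c} _ _.
Arguments idc {c} A.
Arguments comp {c A B C} _ _.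
Notation "g ∘ f" := (comp g f) (at level 40, left associativity) : cat_scope.

(* Equality of morphisms whose end points are only propositionally equal. *)
Inductive heq (C : Cat) (A B : C) (f : hom A B) :
  forall A' B' : C, hom A' B' -> Prop :=
| heq_refl : heq f f.
Arguments heq {C A B} f {A' B'} g.
Arguments heq_refl {C A B} f.

Record Functor (C D : Cat) := {
  fob :> C -> D;
  fmap : forall A B, hom A B -> hom (fob A) (fob B);
  fmap1 : forall A, fmap (idc A) = idc (fob A);
  fmapM : forall A B E (g : hom B E) (f : hom A B),
    fmap (g ∘ f) = fmap g ∘ fmap f
}.
Arguments fmap {C D} F {A B} f : rename.

Definition idF (C : Cat) : Functor C C :=
  {| fob A := A; fmap A B f := f;
     fmap1 A := eq_refl; fmapM A B E g f := eq_refl |}.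

Definition compF (C D E : Cat) (G : Functor D E) (F : Functor C D) : Functor C E.
Proof.
refine {| fob A := G (F A); fmap A B f := fmap G (fmap F f) |}.
- abstract (by move=> A; rewrite !fmap1).
- abstract (by move=> *; rewrite !fmapM).
Defined.

Definition is_iso (C : Cat) (A B : C) (f : hom A B) : Prop :=
  exists g : hom B A, g ∘ f = idc A /\ f ∘ g = idc B.

(* P is the fibre product over B of I copies of q; b is its projection to B. *)
Definition is_wide_pullback (C : Cat) (I : Type) (E B P : C)
    (q : hom E B) (b : hom P B) (pr : I -> hom P E) : Prop :=
  (forall i, q ∘ pr i = b) /\
  forall (X : C) (x : hom X B) (y : I -> hom X E), (forall i, q ∘ y i = x) ->
    exists! u : hom X P, b ∘ u = x /\ forall i, pr i ∘ u = y i.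

Definition is_pullback (C : Cat) (P A B D : C) (f : hom A D) (g : hom B D)
    (pA : hom P A) (pB : hom P B) : Prop :=
  f ∘ pA = g ∘ pB /\
  forall (X : C) (a : hom X A) (b : hom X B), f ∘ a = g ∘ b ->
    exists! u : hom X P, pA ∘ u = a /\ pB ∘ u = b.

(* Data only: q : E -> B with its n-fold fibre products E_n over B, z and s. *)
Record bundle (C : Cat) := Bundle {
  bB : C;
  bE : C;
  bq : hom bE bB;
  bn : nat -> C;
  bbase : forall n, hom (bn n) bB;
  bpr : forall n, Fin.t n -> hom (bn n) bE;
  bz : hom bB bE;
  bs : hom (bn 2) bE
}.
Arguments bbase {C} b n.
Arguments bpr {C} b n i.

Notation bpr1 b := (bpr b 2 Fin.F1).
Notation bpr2 b := (bpr b 2 (Fin.FS Fin.F1)).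
Definition has_nfold (C : Cat) (b : bundle C) : Prop :=
  forall n, is_wide_pullback (bq b) (bbase b n) (bpr b n).

(* The morphisms into the pullbacks [bn b n] over which the laws quantify are
   determined by their projections, and exist because of [has_nfold]. *)
Record additive_bundle (C : Cat) (b : bundle C) : Prop := {
  ab_nfold : has_nfold b;
  ab_qz : bq b ∘ bz b = idc (bB b);
  ab_qs : bq b ∘ bs b = bbase b 2;
  ab_unit : forall u : hom (bE b) (bn b 2),
    bpr1 b ∘ u = bz b ∘ bq b -> bpr2 b ∘ u = idc (bE b) ->
    bs b ∘ u = idc (bE b);
  ab_comm : forall u : hom (bn b 2) (bn b 2),
    bpr1 b ∘ u = bpr2 b -> bpr2 b ∘ u = bpr1 b -> bs b ∘ u = bs b;
  ab_assoc : let pr k := bpr b 3 k in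
    let k1 := Fin.F1 in let k2 := Fin.FS Fin.F1 in
    let k3 := Fin.FS (Fin.FS Fin.F1) in
    forall u12 u23 u v : hom (bn b 3) (bn b 2),
    bpr1 b ∘ u12 = pr k1 -> bpr2 b ∘ u12 = pr k2 ->
    bpr1 b ∘ u23 = pr k2 -> bpr2 b ∘ u23 = pr k3 ->
    bpr1 b ∘ u = bs b ∘ u12 -> bpr2 b ∘ u = pr k3 ->
    bpr1 b ∘ v = pr k1 -> bpr2 b ∘ v = bs b ∘ u23 ->
    bs b ∘ u = bs b ∘ v
}.

Record bundle_morphism (C : Cat) (b b' : bundle C)
    (f : hom (bB b) (bB b')) (g : hom (bE b) (bE b')) : Prop := {
  bm_q : bq b' ∘ g = f ∘ bq b;
  bm_z : g ∘ bz b = bz b' ∘ f;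
  bm_s : forall m : hom (bn b 2) (bn b' 2),
    bpr1 b' ∘ m = g ∘ bpr1 b -> bpr2 b' ∘ m = g ∘ bpr2 b ->
    g ∘ bs b = bs b' ∘ m
}.

Definition bimg (C D : Cat) (F : Functor C D) (b : bundle C) : bundle D :=
  {| bB := F (bB b); bE := F (bE b); bq := fmap F (bq b);
     bn n := F (bn b n); bbase n := fmap F (bbase b n);
     bpr n k := fmap F (bpr b n k);
     bz := fmap F (bz b); bs := fmap F (bs b) |}.

Record TangentData := {
  tcat :> Cat;
  tT : Functor tcat tcat;
  tp : forall A, hom (tT A) A;
  tn : nat -> tcat -> tcat;
  tbase : forall n A, hom (tn n A) A;
  tpr : forall n, Fin.t n -> forall A, hom (tn n A) (tT A);
  tz : forall A, hom A (tT A);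
  ts : forall A, hom (tn 2 A) (tT A);
  tl : forall A, hom (tT A) (tT (tT A));
  tc : forall A, hom (tT (tT A)) (tT (tT A))
}.
Arguments tT {t}.
Arguments tp {t} A.
Arguments tn {t} n A.
Arguments tbase {t} n A.
Arguments tpr {t} n k A : rename.
Arguments tz {t} A.
Arguments ts {t} A.
Arguments tl {t} A.
Arguments tc {t} A.
Notation T A := (fob tT A).
Notation tpr1 A := (tpr 2 Fin.F1 A).
Notation tpr2 A := (tpr 2 (Fin.FS Fin.F1) A).

Definition tbundle (X : TangentData) (A : X) : bundle X :=
  {| bB := A; bE := T A; bq := tp A; bn n := tn n A; bbase n := tbase n A;
     bpr n k := tpr n k A; bz := tz A; bs := ts A |}.

(* [u] is the pairing <l π1, z π2>, so that [T s ∘ u] is φ. *)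
Definition is_lift_pairing (X : TangentData) (A : X)
    (u : hom (tn 2 A) (T (tn 2 A))) : Prop :=
  fmap tT (tpr1 A) ∘ u = tl A ∘ tpr1 A /\
  fmap tT (tpr2 A) ∘ u = tz (T A) ∘ tpr2 A.

Record tangent_laws (X : TangentData) : Prop := {
  tpN : forall (A B : X) (f : hom A B), tp B ∘ fmap tT f = f ∘ tp A;
  tzN : forall (A B : X) (f : hom A B), tz B ∘ f = fmap tT f ∘ tz A;
  tsN : forall (A B : X) (f : hom A B) (m : hom (tn 2 A) (tn 2 B)),
    tpr1 B ∘ m = fmap tT f ∘ tpr1 A ->
    tpr2 B ∘ m = fmap tT f ∘ tpr2 A ->
    ts B ∘ m = fmap tT f ∘ ts A;
  tlN : forall (A B : X) (f : hom A B),
    tl B ∘ fmap tT f = fmap tT (fmap tT f) ∘ tl A;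
  tcN : forall (A B : X) (f : hom A B),
    tc B ∘ fmap tT (fmap tT f) = fmap tT (fmap tT f) ∘ tc A;
  tadd : forall A : X, additive_bundle (tbundle A);
  tpres : forall m (A : X), has_nfold (Nat.iter m (bimg tT) (tbundle A));
  tlB : forall A : X, @bundle_morphism X (tbundle A) (bimg tT (tbundle A))
          (tz A) (tl A);
  tcB : forall A : X, @bundle_morphism X (bimg tT (tbundle A)) (tbundle (T A))
          (idc (T A)) (tc A);
  tll : forall A : X, fmap tT (tl A) ∘ tl A = tl (T A) ∘ tl A;
  tcc : forall A : X, tc A ∘ tc A = idc (T (T A));
  tccc : forall A : X, fmap tT (tc A) ∘ tc (T A) ∘ fmap tT (tc A)
                       = tc (T A) ∘ fmap tT (tc A) ∘ tc (T A);
  tcl : forall A : X, tc A ∘ tl A = tl A;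
  tlc : forall A : X, fmap tT (tl A) ∘ tc A
                      = tc (T A) ∘ fmap tT (tc A) ∘ tl (T A);
  tvl : forall (A : X) u, is_lift_pairing u ->
    is_pullback (fmap tT (tp A)) (tz A)
      (fmap tT (ts A) ∘ u) (tp A ∘ tpr1 A)
}.

Record TangentCat := {
  tdata :> TangentData;
  tlaws : tangent_laws tdata
}.

Record Strong (X Y : TangentCat) := {
  sF :> Functor X Y;
  sa : forall A : X, hom (sF (T A)) (T (sF A));
  saV : forall A : X, hom (T (sF A)) (sF (T A));
  saVK : forall A, saV A ∘ sa A = idc _;
  saKV : forall A, sa A ∘ saV A = idc _;
  saN : forall (A B : X) (f : hom A B),
    sa B ∘ fmap sF (fmap tT f) = fmap tT (fmap sF f) ∘ sa A;
  sB : forall A : X, @bundle_morphism Y (bimg sF (tbundle A)) (tbundle (sF A))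
         (idc (sF A)) (sa A);
  sl : forall A : X, fmap tT (sa A) ∘ sa (T A) ∘ fmap sF (tl A)
                     = tl (sF A) ∘ sa A;
  sc : forall A : X, tc (sF A) ∘ fmap tT (sa A) ∘ sa (T A)
                     = fmap tT (sa A) ∘ sa (T A) ∘ fmap sF (tc A);
  snfold : forall A : X, has_nfold (bimg sF (tbundle A));
  svl : forall (A : X) u, is_lift_pairing u ->
    is_pullback (fmap sF (fmap tT (tp A))) (fmap sF (tz A))
      (fmap sF (fmap tT (ts A) ∘ u)) (fmap sF (tp A ∘ tpr1 A))
}.
Arguments sa {X Y} s A.
Arguments saV {X Y} s A.

(* This forces F (T A) = T (F A) and, by naturality of [sa], F T = T F. *)
Definition is_strict (X Y : TangentCat) (F : Strong X Y) : Prop :=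
  forall A : X, heq (sa F A) (idc (F (T A))).

Record TangentTrans (X Y : TangentCat) (F G : Strong X Y) := {
  nt :> forall A : X, hom (F A) (G A);
  ntN : forall (A B : X) (f : hom A B), nt B ∘ fmap F f = fmap G f ∘ nt A;
  ntT : forall A : X, fmap tT (nt A) ∘ sa F A = sa G A ∘ nt (T A)
}.

Notation pirr := proof_irrelevance.

Lemma heq_existT (C : Cat) (A B : C) (f : hom A B) (A' B' : C) (g : hom A' B') :
  heq f g ->
  existT (fun p : C * C => hom (fst p) (snd p)) (A, B) f
  = existT (fun p : C * C => hom (fst p) (snd p)) (A', B') g.
Proof. by case. Qed.

Lemma heq_eq (C : Cat) (A B : C) (f g : hom A B) : heq f g -> f = g.
Proof. by move/heq_existT; apply: ProofIrrelevanceTheory.EqdepTheory.inj_pair2. Qed.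

Lemma eq_heq (C : Cat) (A B : C) (f g : hom A B) : f = g -> heq f g.
Proof. by move->. Qed.

Lemma heq_sym (C : Cat) (A B : C) (f : hom A B) (A' B' : C) (g : hom A' B') :
  heq f g -> heq g f.
Proof. by case. Qed.

Lemma heq_trans (C : Cat) (A B : C) (f : hom A B) (A' B' : C) (g : hom A' B')
    (A'' B'' : C) (h : hom A'' B'') : heq f g -> heq g h -> heq f h.
Proof. by case. Qed.

Lemma heq_dom (C : Cat) (A B : C) (f : hom A B) (A' B' : C) (g : hom A' B') :
  heq f g -> A = A' /\ B = B'.
Proof. by case. Qed.

Lemma heq_comp (C : Cat) (A B D : C) (g : hom B D) (f : hom A B)
    (A' B' D' : C) (g' : hom B' D') (f' : hom A' B') :
  heq g g' -> heq f f' -> heq (g ∘ f) (g' ∘ f').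
Proof.
move=> hg hf; have [eA eB] := heq_dom hf; have [_ eD] := heq_dom hg.
move: g g' f f' hg hf; rewrite -eA -eB -eD => g g' f f' /heq_eq -> /heq_eq ->.
exact: heq_refl.
Qed.

Lemma heq_idc (C : Cat) (A B : C) : A = B -> heq (idc A) (idc B).
Proof. by move=> ->. Qed.

Lemma heq_fmap (C D : Cat) (F : Functor C D) (A B : C) (f : hom A B)
  (A' B' : C) (g : hom A' B') : heq f g -> heq (fmap F f) (fmap F g).
Proof. by case. Qed.

Lemma functor_ext (C D : Cat) (F G : Functor C D) :
  (forall A, F A = G A) ->
  (forall A B (f : hom A B), heq (fmap F f) (fmap G f)) -> F = G.
Proof.
case: F G => [Fo Fm F1 F2] [Go Gm G1 G2] /= eo em.
have eo' : Fo = Go by apply: functional_extensionality.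
subst Go; have em' : Fm = Gm.
  do 3 (apply: functional_extensionality_dep => ?); apply: heq_eq; exact: em.
subst Gm; by rewrite (pirr _ F1 G1) (pirr _ F2 G2).
Qed.

Lemma strong_ext (X Y : TangentCat) (F G : Strong X Y) :
  (forall A, F A = G A) ->
  (forall (A B : X) (f : hom A B), heq (fmap F f) (fmap G f)) ->
  (forall A, heq (sa F A) (sa G A)) -> F = G.
Proof.
case: F G => [F a v k1 k2 n b l c pn pv] [G a' v' k1' k2' n' b' l' c' pn' pv'] /=.
move=> eo em ea; have e : F = G by exact: functor_ext.
subst G; have e : a = a'.
  by apply: functional_extensionality_dep => A; apply: heq_eq.
subst a'; have e : v = v'.
  apply: functional_extensionality_dep => A.
  by rewrite -[v A]compf1 -(k2' A) compA k1 comp1f.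
subst v'.
by rewrite (pirr _ k1 k1') (pirr _ k2 k2') (pirr _ n n') (pirr _ b b')
  (pirr _ l l') (pirr _ c c') (pirr _ pn pn') (pirr _ pv pv').
Qed.

Lemma trans_ext (X Y : TangentCat) (F G : Strong X Y) (t t' : TangentTrans F G) :
  (forall A, t A = t' A) -> t = t'.
Proof.
case: t t' => [t n c] [t' n' c'] /= e.
have e' : t = t' by apply: functional_extensionality_dep.
by subst t'; rewrite (pirr _ n n') (pirr _ c c').
Qed.

Definition iso_pair (C : Cat) (A B : C) (f : hom A B) (fV : hom B A) : Prop :=
  fV ∘ f = idc A /\ f ∘ fV = idc B.

Definition diag_iso (C : Cat) (b b' : bundle C) : Prop :=
  exists f fV, @iso_pair C (bB b) (bB b') f fV /\
  exists g gV, @iso_pair C (bE b) (bE b') g gV /\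
  bq b' ∘ g = f ∘ bq b /\
  forall n, exists u uV, @iso_pair C (bn b n) (bn b' n) u uV /\
   bbase b' n ∘ u = f ∘ bbase b n /\
   forall k, bpr b' n k ∘ u = g ∘ bpr b n k.

Lemma iso_cancelL (C : Cat) (A B D : C) (f : hom A B) (fV : hom B A) :
  fV ∘ f = idc _ -> forall g h : hom D A, f ∘ g = f ∘ h -> g = h.
Proof. by move=> e g h /(f_equal (comp fV)); rewrite !compA e !comp1f. Qed.

Lemma iso_moveL (C : Cat) (A B D : C) (f : hom A B) (fV : hom B A)
  (g : hom D A) (h : hom D B) :
  fV ∘ f = idc _ -> f ∘ g = h -> g = fV ∘ h.
Proof. by move=> e <-; rewrite compA e comp1f. Qed.

Lemma di_img (C D : Cat) (F : Functor C D) (b b' : bundle C) :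
  diag_iso b b' -> diag_iso (bimg F b) (bimg F b').
Proof.
case=> f [fV [[ff ff'] [g [gV [[gg gg'] [eq un]]]]]].
exists (fmap F f), (fmap F fV); split.
  by split; rewrite -fmapM ?ff ?ff' fmap1.
exists (fmap F g), (fmap F gV); split.
  by split; rewrite -fmapM ?gg ?gg' fmap1.
split=> [|n]; first by rewrite /= -!fmapM eq.
case: (un n) => u [uV [[uu uu'] [eb ep]]].
exists (fmap F u), (fmap F uV); split.
  by split; rewrite -fmapM ?uu ?uu' fmap1.
by split=> [|k] /=; rewrite -!fmapM ?eb ?ep.
Qed.

Lemma di_sym (C : Cat) (b b' : bundle C) : diag_iso b b' -> diag_iso b' b.
Proof.
case=> f [fV [[ff ff'] [g [gV [[gg gg'] [eq un]]]]]].
exists fV, f; split=> //; exists gV, g; split=> //.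
split=> [|n].
  by apply: (iso_moveL ff); rewrite compA -eq -compA gg' compf1.
case: (un n) => u [uV [[uu uu'] [eb ep]]].
exists uV, u; split=> //; split=> [|k].
  by apply: (iso_moveL ff); rewrite compA -eb -compA uu' compf1.
by apply: (iso_moveL gg); rewrite compA -ep -compA uu' compf1.
Qed.

Lemma di_nfold (C : Cat) (b b' : bundle C) :
  diag_iso b b' -> has_nfold b -> has_nfold b'.
Proof.
move/di_sym=> [f [fV [[ff ff'] [g [gV [[gg gg'] [eq un]]]]]]] H n.
case: (H n) (un n) => [comm univ] [u [uV [[u1 u2] [eb ep]]]]; split.
- move=> k; apply: (iso_cancelL ff); rewrite compA -eq.
  by rewrite -compA -ep compA comm eb.
move=> X x y xy.
have [|m [[m1 m2] mu]] := univ X (f ∘ x) (fun k => g ∘ y k).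
  by move=> k; rewrite compA eq -compA xy.
exists (uV ∘ m); split; [split|].
- by apply: (iso_cancelL ff); rewrite !compA -eb -(compA _ _ uV) u2 compf1.
- move=> k; apply: (iso_cancelL gg); rewrite !compA -ep.
  by rewrite -(compA _ _ uV) u2 compf1.
- move=> v [v1 v2]; apply: (iso_cancelL u1); rewrite compA u2 comp1f.
  apply: mu; split; first by rewrite compA eb -compA v1.
  by move=> k; rewrite compA ep -compA v2.
Qed.

Lemma di_iter (C : Cat) (F : Functor C C) m (b b' : bundle C) :
  diag_iso b b' -> diag_iso (Nat.iter m (bimg F) b) (Nat.iter m (bimg F) b').
Proof. by move=> H; elim: m => //= m IH; apply: di_img. Qed.

Lemma wp_mono (C : Cat) (I : Type) (E B P : C) (q : hom E B) (b : hom P B)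
    (pr : I -> hom P E) : is_wide_pullback q b pr ->
  forall (X : C) (u v : hom X P), b ∘ u = b ∘ v ->
    (forall i, pr i ∘ u = pr i ∘ v) -> u = v.
Proof.
case=> c H X u v e1 e2; have [|w [_ wu]] := H X (b ∘ u) (fun i => pr i ∘ u).
  by move=> i; rewrite compA c.
transitivity w; first by symmetry; apply: wu.
by apply: wu; split=> [|i]; rewrite ?e1 ?e2.
Qed.

Lemma fin2 (P : Fin.t 2 -> Prop) :
  P Fin.F1 -> P (Fin.FS Fin.F1) -> forall k, P k.
Proof.
move=> p1 p2 k; apply: (Fin.caseS' k P) => // k1.
apply: (Fin.caseS' k1 (fun i => P (Fin.FS i))) => // k2.
exact: (Fin.case0 (fun i => P (Fin.FS (Fin.FS i)))).
Qed.

Lemma nfold2_mono (C : Cat) (b : bundle C) : has_nfold b ->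
  forall X (u v : hom X (bn b 2)),
  bpr1 b ∘ u = bpr1 b ∘ v -> bpr2 b ∘ u = bpr2 b ∘ v -> u = v.
Proof.
move=> H X u v e1 e2; apply: (wp_mono (H 2)); last by apply: fin2.
by rewrite -(proj1 (H 2) Fin.F1) -!compA; congr (_ ∘ _).
Qed.

Lemma nfold2_ex (C : Cat) (b : bundle C) : has_nfold b ->
  forall X (x y : hom X (bE b)), bq b ∘ x = bq b ∘ y ->
  exists u, bpr1 b ∘ u = x /\ bpr2 b ∘ u = y.
Proof.
move=> H X x y e.
have [|u [[_ u2] _]] := proj2 (H 2) X (bq b ∘ x)
  (fun k => match k with Fin.F1 => x | Fin.FS _ => y end).
  by apply: fin2.
by exists u; split; [apply: (u2 Fin.F1)|apply: (u2 (Fin.FS Fin.F1))].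
Qed.

Lemma strong_di (X Y : TangentCat) (F : Strong X Y) (A : X) :
  diag_iso (bimg F (tbundle A)) (tbundle (F A)).
Proof.
have eq : tp (F A) ∘ sa F A = fmap F (tp A).
  by have := bm_q (sB F A); rewrite /= comp1f.
have eq' : fmap F (tp A) ∘ saV F A = tp (F A).
  by rewrite -eq -compA saKV compf1.
have nY := ab_nfold (tadd (tlaws Y) (F A)).
have nX := snfold F A.
exists (idc _), (idc _); split; first by split; rewrite comp1f.
exists (sa F A), (saV F A); split; first by split; rewrite (saVK, saKV).
split=> [|n]; first by rewrite comp1f.
have [|u [[u1 u2] _]] := proj2 (nY n) _ (fmap F (tbase n A))
     (fun k => sa F A ∘ fmap F (tpr n k A)).
  move=> k; rewrite /= compA eq -fmapM; congr (fmap F _).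
  exact: (proj1 (ab_nfold (tadd (tlaws X) A) n)).
have [|v [[v1 v2] _]] := proj2 (nX n) _ (tbase n (F A))
     (fun k => saV F A ∘ tpr n k (F A)).
  by move=> k; rewrite /= compA eq'; exact: (proj1 (nY n)).
exists u, v; split; last by split=> //; rewrite comp1f.
rewrite /= in u1 u2 v1 v2; split.
- apply: (wp_mono (nX n)) => [|k] /=; rewrite compf1 compA ?v1 ?u1 //.
  by rewrite v2 -compA u2 compA saVK comp1f.
- apply: (wp_mono (nY n)) => [|k] /=; rewrite compf1 compA ?v1 ?u1 //.
  by rewrite u2 -compA v2 compA saKV comp1f.
Qed.

Lemma strong_pair_di (X Y : TangentCat) (F : Strong X Y) (A : X) :
  exists u uV, @iso_pair Y (F (tn 2 A)) (tn 2 (F A)) u uV /\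
    tpr1 (F A) ∘ u = sa F A ∘ fmap F (tpr1 A) /\
    tpr2 (F A) ∘ u = sa F A ∘ fmap F (tpr2 A) /\
    ts (F A) ∘ u = sa F A ∘ fmap F (ts A).
Proof.
have nY := ab_nfold (tadd (tlaws Y) (F A)).
have eq : tp (F A) ∘ sa F A = fmap F (tp A).
  by have := bm_q (sB F A); rewrite /= comp1f.
have nX := snfold F A.
have eX := proj1 (ab_nfold (tadd (tlaws X) A) 2).
have eY := proj1 (nY 2).
have [|u [u1 u2]] := nfold2_ex nY (x := sa F A ∘ fmap F (tpr1 A))
  (y := sa F A ∘ fmap F (tpr2 A)).
  by rewrite /= !compA eq -!fmapM !eX.
have [|v [v1 v2]] := nfold2_ex nX (x := saV F A ∘ tpr1 (F A))
  (y := saV F A ∘ tpr2 (F A)).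
  by rewrite /= -eq -!compA !(compA (sa F A)) saKV !comp1f !eY.
rewrite /= in u1 u2 v1 v2.
exists u, v; split; [split|do !split=> //].
- apply: (nfold2_mono nX) => /=; rewrite compf1 compA ?v1 ?v2 -compA ?u1 ?u2.
    by rewrite compA saVK comp1f.
  by rewrite compA saVK comp1f.
- apply: (nfold2_mono nY) => /=; rewrite compf1 compA ?u1 ?u2 -compA ?v1 ?v2.
    by rewrite compA saKV comp1f.
  by rewrite compA saKV comp1f.
- by symmetry; apply: (bm_s (sB F A)).
Qed.

Lemma pullback_iso (C : Cat) (P A B D P' A' B' D' : C)
  (f : hom A D) (g : hom B D) (pA : hom P A) (pB : hom P B)
  (f' : hom A' D') (g' : hom B' D') (pA' : hom P' A') (pB' : hom P' B')
  (iP : hom P P') (iA : hom A A') (iB : hom B B') (iD : hom D D')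
  (jP : hom P' P) (jA : hom A' A) (jB : hom B' B) (jD : hom D' D) :
  iso_pair iP jP -> iso_pair iA jA -> iso_pair iB jB -> iso_pair iD jD ->
  iD ∘ f = f' ∘ iA -> iD ∘ g = g' ∘ iB ->
  iA ∘ pA = pA' ∘ iP -> iB ∘ pB = pB' ∘ iP ->
  is_pullback f' g' pA' pB' -> is_pullback f g pA pB.
Proof.
move=> [P1 P2] [A1 A2] [B1 B2] [D1 D2] ef eg ea eb [c H]; split.
  by apply: (iso_cancelL D1); rewrite !compA ef eg -!compA ea eb !compA c.
move=> X a b ab.
have [|u [[u1 u2] uu]] := H X (iA ∘ a) (iB ∘ b).
  by rewrite !compA -ef -eg -!compA ab.
exists (jP ∘ u); split; [split|].
- by apply: (iso_cancelL A1); rewrite !compA ea -(compA _ iP) P2 compf1.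
- by apply: (iso_cancelL B1); rewrite !compA eb -(compA _ iP) P2 compf1.
- move=> v [v1 v2]; apply: (iso_cancelL P1); rewrite compA P2 comp1f.
  by apply: uu; rewrite !compA -ea -eb -!compA v1 v2.
Qed.

Lemma sp (X Y : TangentCat) (F : Strong X Y) (A : X) :
  tp (F A) ∘ sa F A = fmap F (tp A).
Proof. by have := bm_q (sB F A); rewrite /= comp1f. Qed.

Lemma sz (X Y : TangentCat) (F : Strong X Y) (A : X) :
  sa F A ∘ fmap F (tz A) = tz (F A).
Proof. by have := bm_z (sB F A); rewrite /= compf1. Qed.

Lemma saVN (X Y : TangentCat) (F : Strong X Y) (A B : X) (f : hom A B) :
  saV F B ∘ fmap tT (fmap F f) = fmap F (fmap tT f) ∘ saV F A.
Proof.
symmetry; apply: (iso_moveL (saVK F B)); rewrite compA saN -compA saKV.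
by rewrite compf1.
Qed.

Lemma pair_transport (X Y : TangentCat) (F : Strong X Y) (A : X) u v vV w :
  @is_lift_pairing X A u -> @iso_pair Y (F (tn 2 A)) (tn 2 (F A)) v vV ->
  tpr1 (F A) ∘ v = sa F A ∘ fmap F (tpr1 A) ->
  tpr2 (F A) ∘ v = sa F A ∘ fmap F (tpr2 A) ->
  w = fmap tT v ∘ sa F (tn 2 A) ∘ fmap F u ∘ vV ->
  @is_lift_pairing Y (F A) w.
Proof.
move=> [u1 u2] [vv vv'] v1 v2 ->; split; rewrite !compA -fmapM.
- rewrite v1 fmapM -(compA (fmap tT (sa F A))) -saN compA.
  rewrite -(compA _ (fmap F (fmap tT _))) -fmapM u1 fmapM compA sl.
  by rewrite -(compA (tl _)) -v1 -!compA vv' compf1.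
- rewrite v2 fmapM -(compA (fmap tT (sa F A))) -saN compA.
  rewrite -(compA _ (fmap F (fmap tT _))) -fmapM u2 fmapM compA.
  rewrite -(compA (fmap tT (sa F A))) sz -(tzN (tlaws Y)).
  by rewrite -(compA (tz _)) -v2 -!compA vv' compf1.
Qed.

Lemma bm_id (C : Cat) (b : bundle C) : has_nfold b ->
  @bundle_morphism C b b (idc _) (idc _).
Proof.
move=> n; split=> [| |m]; rewrite ?comp1f ?compf1 // => m1 m2.
suff -> : m = idc _ by rewrite compf1.
by apply: (nfold2_mono n); rewrite compf1.
Qed.

Definition strong_id (X : TangentCat) : Strong X X.
Proof.
refine {| sF := idF X; sa A := idc _; saV A := idc _ |}.
- abstract (by move=> *; rewrite comp1f).
- abstract (by move=> *; rewrite comp1f).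
- abstract (by move=> *; rewrite comp1f compf1).
- abstract (by move=> A; apply: bm_id; apply: (ab_nfold (tadd (tlaws X) A))).
- abstract (by move=> A; rewrite /= fmap1 !comp1f compf1).
- abstract (by move=> A; rewrite /= fmap1 !comp1f !compf1).
- abstract (by move=> A; apply: (ab_nfold (tadd (tlaws X) A))).
- abstract (by move=> A u H; apply: (tvl (tlaws X))).
Defined.

Section StrongComp.
Variables (X Y Z : TangentCat) (G : Strong Y Z) (F : Strong X Y).

Lemma strong_comp_VK : forall A : X, fmap G (saV F A) ∘ saV G (F A) ∘ (sa G (F A) ∘ fmap G (sa F A)) = idc (G (F (T A))).
Proof.
move=> A /=; rewrite -compA (compA (saV G _)) saVK comp1f -fmapM saVK.
exact: fmap1.
Qed.

Lemma strong_comp_KV : forall A : X, sa G (F A) ∘ fmap G (sa F A) ∘ (fmap G (saV F A) ∘ saV G (F A)) = idc (T (G (F A))).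
Proof.
move=> A /=; rewrite -compA (compA (fmap G (sa F A))) -fmapM saKV fmap1 comp1f.
exact: saKV.
Qed.

Lemma strong_comp_N : forall (A B : X) (f : hom A B), sa G (F B) ∘ fmap G (sa F B) ∘ fmap (compF G F) (fmap tT f)
    = fmap tT (fmap (compF G F) f) ∘ (sa G (F A) ∘ fmap G (sa F A)).
Proof.
move=> A B f /=.
by rewrite -compA -fmapM saN fmapM compA saN -compA.
Qed.

Lemma strong_comp_B : forall A : X, @bundle_morphism Z (bimg (compF G F) (tbundle A)) (tbundle (G (F A)))
    (idc (G (F A))) (sa G (F A) ∘ fmap G (sa F A)).
Proof.
move=> A; split=> /=.
+ by rewrite comp1f compA sp -fmapM sp.
+ by rewrite compf1 -compA -fmapM sz sz.
+ move=> m m1 m2.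
  have [u [_ [_ [u1 [u2 u3]]]]] := strong_pair_di F A.
  have [v [_ [_ [v1 [v2 v3]]]]] := strong_pair_di G (F A).
  rewrite -compA -fmapM -u3 fmapM compA -v3 -compA; congr (_ ∘ _).
  apply: (nfold2_mono (ab_nfold (tadd (tlaws Z) _))) => /=.
    rewrite [RHS]m1 compA v1 -compA -fmapM u1 -compA -fmapM //.
  rewrite [RHS]m2 compA v2 -compA -fmapM u2 -compA -fmapM //.
Qed.

Lemma strong_comp_l : forall A : X, fmap tT (sa G (F A) ∘ fmap G (sa F A)) ∘
    (sa G (F (T A)) ∘ fmap G (sa F (T A))) ∘ fmap (compF G F) (tl A)
    = tl (G (F A)) ∘ (sa G (F A) ∘ fmap G (sa F A)).
Proof.
move=> A /=; rewrite fmapM !compA -(compA _ _ (sa G (F (T A)))) -saN.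
by rewrite compA -!(compA _ (fmap G _)) -!fmapM compA sl fmapM compA sl.
Qed.

Lemma strong_comp_c : forall A : X, tc (G (F A)) ∘ fmap tT (sa G (F A) ∘ fmap G (sa F A)) ∘
    (sa G (F (T A)) ∘ fmap G (sa F (T A)))
    = fmap tT (sa G (F A) ∘ fmap G (sa F A)) ∘
      (sa G (F (T A)) ∘ fmap G (sa F (T A))) ∘ fmap (compF G F) (tc A).
Proof.
move=> A /=; rewrite fmapM !compA -(compA _ _ (sa G (F (T A)))) -saN.
rewrite -(compA (fmap tT (sa G _)) (fmap tT (fmap G _))) -saN !compA.
rewrite sc -!(compA _ (fmap G _)) -!fmapM !compA sc.
by rewrite -!compA.
Qed.

Lemma strong_comp_nfold : forall A : X, has_nfold (bimg (compF G F) (tbundle A)).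
Proof.
move=> A; apply: (di_nfold (b := bimg G (tbundle (F A)))); last exact: snfold.
exact: di_img (di_sym (strong_di F A)).
Qed.

Lemma strong_comp_vl : forall (A : X) u, is_lift_pairing u ->
    is_pullback (fmap (compF G F) (fmap tT (tp A))) (fmap (compF G F) (tz A))
      (fmap (compF G F) (fmap tT (ts A) ∘ u)) (fmap (compF G F) (tp A ∘ tpr1 A)).
Proof.
move=> A u H.
have [v [vV [vv [v1 [v2 v3]]]]] := strong_pair_di F A.
pose w := fmap tT v ∘ sa F (tn 2 A) ∘ fmap F u ∘ vV.
have W := svl G (pair_transport H vv v1 v2 (eq_refl w)).
have im B D (f : hom B D) g : iso_pair f g -> iso_pair (fmap G f) (fmap G g).
  by case=> e1 e2; split; rewrite -fmapM ?e1 ?e2 fmap1.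
apply: (pullback_iso (im _ _ _ _ vv)
  (im _ _ (fmap tT (sa F A) ∘ sa F (T A))
     (saV F (T A) ∘ fmap tT (saV F A)) _)
  (im _ _ (idc _) (idc _) _) (im _ _ (sa F A) (saV F A) _) _ _ _ _ W).
+ split.
    by rewrite -compA (compA (fmap tT _)) -fmapM saVK fmap1 comp1f saVK.
  by rewrite -compA (compA (sa F _)) saKV comp1f -fmapM saKV fmap1.
+ by split; rewrite comp1f.
+ by split; rewrite (saVK, saKV).
+ by rewrite /= -!fmapM saN compA -fmapM sp -saN.
+ by rewrite /= -!fmapM sz compf1.
+ rewrite /= -!fmapM; congr (fmap G _); rewrite fmapM !compA.
  rewrite -(compA _ (sa F (T A))) saN compA -fmapM -v3 /w !fmapM.
  by rewrite -!compA (proj1 vv) compf1.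
+ rewrite /= -!fmapM comp1f; congr (fmap G _).
  by rewrite -compA v1 compA sp -fmapM.
Qed.

Definition strong_comp : Strong X Z :=
  {| sF := compF G F; sa A := sa G (F A) ∘ fmap G (sa F A);
     saV A := fmap G (saV F A) ∘ saV G (F A);
     saVK := strong_comp_VK; saKV := strong_comp_KV; saN := strong_comp_N;
     sB := strong_comp_B; sl := strong_comp_l; sc := strong_comp_c;
     snfold := strong_comp_nfold; svl := strong_comp_vl |}.
End StrongComp.

Definition trans_id (X Y : TangentCat) (F : Strong X Y) : TangentTrans F F.
Proof.
refine {| nt A := idc (F A) |}.
- abstract (by move=> *; rewrite comp1f compf1).
- abstract (by move=> *; rewrite fmap1 comp1f compf1).
Defined.

Definition trans_comp (X Y : TangentCat) (F G H : Strong X Y)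
  (t' : TangentTrans G H) (t : TangentTrans F G) : TangentTrans F H.
Proof.
refine {| nt A := t' A ∘ t A |}.
- abstract (by move=> A B f; rewrite -compA ntN compA ntN compA).
- abstract (by move=> A; rewrite fmapM -compA ntT compA ntT compA).
Defined.

Definition trans_wl (X Y Z : TangentCat) (H : Strong Y Z) (F G : Strong X Y)
  (t : TangentTrans F G) : TangentTrans (strong_comp H F) (strong_comp H G).
Proof.
refine (@Build_TangentTrans _ _ (strong_comp H F) (strong_comp H G)
  (fun A => fmap H (t A)) _ _).
- abstract (by move=> A B f /=; rewrite -!fmapM ntN).
- abstract (by move=> A /=; rewrite compA -saN -!compA -!fmapM ntT).
Defined.

Definition trans_wr (X Y Z : TangentCat) (G H : Strong Y Z)
  (t : TangentTrans G H) (F : Strong X Y) :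
  TangentTrans (strong_comp G F) (strong_comp H F).
Proof.
refine (@Build_TangentTrans _ _ (strong_comp G F) (strong_comp H F)
  (fun A => t (F A)) _ _).
- abstract (by move=> A B f /=; rewrite ntN).
- abstract (by move=> A /=; rewrite compA ntT -!compA ntN).
Defined.

Inductive heq2 (O : Type) (H1 : O -> O -> Type)
    (H2 : forall A B : O, H1 A B -> H1 A B -> Type) (A B : O) (f g : H1 A B)
    (t : H2 A B f g) : forall f' g' : H1 A B, H2 A B f' g' -> Prop :=
| heq2_refl : heq2 t t.
Arguments heq2 {O H1 H2 A B f g} t {f' g'} t'.
Arguments heq2_refl {O H1 H2 A B f g} t.

(* Strict 2-categories; [wl] and [wr] are the two whiskerings. *)
Record TwoCat := {
  ob2 :> Type;
  one : ob2 -> ob2 -> Type;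
  two : forall A B, one A B -> one A B -> Type;
  id1 : forall A, one A A;
  comp1 : forall A B C, one B C -> one A B -> one A C;
  id2 : forall A B (f : one A B), two f f;
  vcomp : forall A B (f g h : one A B), two g h -> two f g -> two f h;
  wl : forall A B C (h : one B C) (f g : one A B),
    two f g -> two (comp1 h f) (comp1 h g);
  wr : forall A B C (g h : one B C), two g h ->
    forall f : one A B, two (comp1 g f) (comp1 h f);
  comp1A : forall A B C D (h : one C D) (g : one B C) (f : one A B),
    comp1 h (comp1 g f) = comp1 (comp1 h g) f;
  comp1Il : forall A B (f : one A B), comp1 (id1 B) f = f;
  comp1Ir : forall A B (f : one A B), comp1 f (id1 A) = f;
  vcompA : forall A B (f g h k : one A B)
    (w : two h k) (v : two g h) (u : two f g),
    vcomp w (vcomp v u) = vcomp (vcomp w v) u;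
  vcompIl : forall A B (f g : one A B) (t : two f g), vcomp (id2 g) t = t;
  vcompIr : forall A B (f g : one A B) (t : two f g), vcomp t (id2 f) = t;
  wl_id2 : forall A B C (h : one B C) (f : one A B),
    wl h (id2 f) = id2 (comp1 h f);
  wl_vcomp : forall A B C (k : one B C) (f g h : one A B)
    (v : two g h) (u : two f g), wl k (vcomp v u) = vcomp (wl k v) (wl k u);
  wr_id2 : forall A B C (g : one B C) (f : one A B),
    wr (id2 g) f = id2 (comp1 g f);
  wr_vcomp : forall A B C (f : one A B) (g h k : one B C)
    (v : two h k) (u : two g h), wr (vcomp v u) f = vcomp (wr v f) (wr u f);
  wl_id1 : forall A B (f g : one A B) (t : two f g), heq2 (wl (id1 B) t) t;
  wl_comp1 : forall A B C D (k : one C D) (h : one B C) (f g : one A B)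
    (t : two f g), heq2 (wl (comp1 k h) t) (wl k (wl h t));
  wr_id1 : forall A B (f g : one A B) (t : two f g), heq2 (wr t (id1 A)) t;
  wr_comp1 : forall A B C D (h k : one C D) (t : two h k) (g : one B C)
    (f : one A B), heq2 (wr t (comp1 g f)) (wr (wr t g) f);
  wl_wr : forall A B C D (h : one C D) (g k : one B C) (t : two g k)
    (f : one A B), heq2 (wr (wl h t) f) (wl h (wr t f));
  interchange : forall A B C (f g : one A B) (h k : one B C)
    (t : two f g) (t' : two h k),
    vcomp (wr t' g) (wl h t) = vcomp (wl k t) (wr t' f)
}.
Arguments one {t} A B : rename.
Arguments two {t A B} f g : rename.
Arguments id1 {t} A : rename.
Arguments comp1 {t A B C} g f : rename.
Arguments id2 {t A B} f : rename.
Arguments vcomp {t A B f g h} v u : rename.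
Arguments wl {t A B C} h {f g} u : rename.
Arguments wr {t A B C g h} u f : rename.
Notation "g ⋅ f" := (comp1 g f) (at level 40, left associativity) : cat_scope.

Lemma trans_heq2 (X Y : TangentCat) (F F' G G' : Strong X Y)
    (t : TangentTrans F G) (t' : TangentTrans F' G') : F = F' -> G = G' ->
  (forall A, heq (t A) (t' A)) -> @heq2 TangentCat Strong TangentTrans _ _ _ _ t _ _ t'.
Proof.
move=> e e'; subst F' G' => H.
have -> : t = t' by apply: trans_ext => A; apply: heq_eq.
exact: heq2_refl.
Qed.

Lemma strong_compA (X Y Z W : TangentCat) (H : Strong Z W) (G : Strong Y Z)
  (F : Strong X Y) :
  strong_comp H (strong_comp G F) = strong_comp (strong_comp H G) F.
Proof.
apply: strong_ext => [A|A B f|A]; [by []|exact: heq_refl|apply: eq_heq].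
by rewrite /= fmapM compA.
Qed.

Lemma strong_compIl (X Y : TangentCat) (F : Strong X Y) :
  strong_comp (strong_id Y) F = F.
Proof.
apply: strong_ext => [A|A B f|A]; [by []|exact: heq_refl|apply: eq_heq].
exact: comp1f.
Qed.

Lemma strong_compIr (X Y : TangentCat) (F : Strong X Y) :
  strong_comp F (strong_id X) = F.
Proof.
apply: strong_ext => [A|A B f|A]; [by []|exact: heq_refl|apply: eq_heq].
by rewrite /= fmap1; apply: compf1.
Qed.

Definition TngCat : TwoCat.
Proof.
refine {| ob2 := TangentCat; one := Strong; two := TangentTrans;
  id1 := strong_id; comp1 := strong_comp; id2 := trans_id;
  vcomp := trans_comp; wl := trans_wl; wr := trans_wr |}.
- abstract (exact: strong_compA).
- abstract (exact: strong_compIl).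
- abstract (exact: strong_compIr).
- abstract (by move=> *; apply: trans_ext => A; apply: compA).
- abstract (by move=> *; apply: trans_ext => A; apply: comp1f).
- abstract (by move=> *; apply: trans_ext => A; apply: compf1).
- abstract (by move=> *; apply: trans_ext => A0 /=; rewrite fmap1).
- abstract (by move=> *; apply: trans_ext => A0 /=; rewrite fmapM).
- abstract (by move=> *; apply: trans_ext).
- abstract (by move=> *; apply: trans_ext).
- abstract (move=> *; apply: trans_heq2; rewrite ?strong_compIl // => A; exact: heq_refl).
- abstract (move=> *; apply: trans_heq2; rewrite ?strong_compA // => A; exact: heq_refl).
- abstract (move=> *; apply: trans_heq2; rewrite ?strong_compIr // => A; exact: heq_refl).
- abstract (move=> *; apply: trans_heq2; rewrite ?strong_compA // => A; exact: heq_refl).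
- abstract (move=> *; apply: trans_heq2; rewrite ?strong_compA // => A; exact: heq_refl).
- abstract (by move=> *; apply: trans_ext => A0 /=; rewrite ntN).
Defined.

Record SliceOb (K : TwoCat) (X : K) := {
  sob : K;
  smap : one sob X
}.
Arguments sob {K X} s.
Arguments smap {K X} s.

Record SliceOne (K : TwoCat) (X : K) (S S' : SliceOb X) := {
  s1 : one (sob S) (sob S');
  s1_over : smap S' ⋅ s1 = smap S
}.
Arguments s1 {K X S S'} s.

Record SliceTwo (K : TwoCat) (X : K) (S S' : SliceOb X) (F G : SliceOne S S') := {
  s2 : two (s1 F) (s1 G);
  s2_over : heq2 (wl (smap S') s2) (id2 (smap S))
}.
Arguments s2 {K X S S' F G} s.

Section Slice.
Variables (K : TwoCat) (X : K).

Lemma heq2_existT (A B : K) (f g f' g' : one A B) (t : two f g)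
  (t' : two f' g') : heq2 t t' ->
  existT (fun p : one A B * one A B => two (fst p) (snd p)) (f, g) t
  = existT (fun p : one A B * one A B => two (fst p) (snd p)) (f', g') t'.
Proof. by case. Qed.

Lemma heq2_eq (A B : K) (f g : one A B) (t t' : two f g) : heq2 t t' -> t = t'.
Proof.
by move/heq2_existT; apply: ProofIrrelevanceTheory.EqdepTheory.inj_pair2.
Qed.

Lemma heq2_bd (A B : K) (f g f' g' : one A B) (t : two f g) (t' : two f' g') :
  heq2 t t' -> f = f' /\ g = g'.
Proof. by case. Qed.

Lemma heq2_sym (A B : K) (f g f' g' : one A B) (t : two f g) (t' : two f' g') :
  heq2 t t' -> heq2 t' t.
Proof. by case. Qed.

Lemma heq2_trans (A B : K) (f g f' g' f'' g'' : one A B) (t : two f g)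
  (t' : two f' g') (t'' : two f'' g'') :
  heq2 t t' -> heq2 t' t'' -> heq2 t t''.
Proof. by case. Qed.

Lemma heq2_wl (A B C : K) (h : one B C) (f g f' g' : one A B) (t : two f g)
  (t' : two f' g') : heq2 t t' -> heq2 (wl h t) (wl h t').
Proof. by case. Qed.

Lemma heq2_wr (A B C : K) (h : one A B) (f g f' g' : one B C) (t : two f g)
  (t' : two f' g') : heq2 t t' -> heq2 (wr t h) (wr t' h).
Proof. by case. Qed.

Lemma heq2_vcomp_id (A B : K) (f g h k : one A B) (v : two g h) (u : two f g) :
  heq2 v (id2 k) -> heq2 u (id2 k) -> heq2 (vcomp v u) (id2 k).
Proof.
move=> hv hu; have [e1 e2] := heq2_bd hv; have [e3 e4] := heq2_bd hu.
subst; rewrite (heq2_eq hv) (heq2_eq hu) vcompIl; exact: heq2_refl.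
Qed.

Lemma slice1_ext (S S' : SliceOb X) (F G : SliceOne S S') : s1 F = s1 G -> F = G.
Proof.
case: F G => [f p] [g q] /= e; subst g; by rewrite (pirr _ p q).
Qed.

Lemma slice2_ext (S S' : SliceOb X) (F G : SliceOne S S') (t u : SliceTwo F G) :
  s2 t = s2 u -> t = u.
Proof.
case: t u => [t p] [u q] /= e; subst u; by rewrite (pirr _ p q).
Qed.

Lemma slice_heq2 (S S' : SliceOb X) (F G F' G' : SliceOne S S')
  (t : SliceTwo F G) (u : SliceTwo F' G') : heq2 (s2 t) (s2 u) ->
  @heq2 _ _ (@SliceTwo K X) _ _ _ _ t _ _ u.
Proof.
move=> h; have [/slice1_ext e1 /slice1_ext e2] := heq2_bd h; subst F' G'.
have -> : t = u by apply: slice2_ext; apply: heq2_eq.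
exact: heq2_refl.
Qed.

Definition slice_id1 (S : SliceOb X) : SliceOne S S :=
  {| s1 := id1 (sob S); s1_over := comp1Ir (smap S) |}.

Definition slice_comp1 (S S' S'' : SliceOb X) (G : SliceOne S' S'')
  (F : SliceOne S S') : SliceOne S S''.
Proof.
refine {| s1 := s1 G ⋅ s1 F |}.
abstract (by rewrite comp1A !s1_over).
Defined.

Definition slice_id2 (S S' : SliceOb X) (F : SliceOne S S') : SliceTwo F F.
Proof.
refine {| s2 := id2 (s1 F) |}.
abstract (by rewrite wl_id2 s1_over; apply: heq2_refl).
Defined.

Definition slice_vcomp (S S' : SliceOb X) (F G H : SliceOne S S')
  (v : SliceTwo G H) (u : SliceTwo F G) : SliceTwo F H.
Proof.
refine {| s2 := vcomp (s2 v) (s2 u) |}.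
abstract (by rewrite wl_vcomp; apply: heq2_vcomp_id; apply: s2_over).
Defined.

Definition slice_wl (S S' S'' : SliceOb X) (H : SliceOne S' S'')
  (F G : SliceOne S S') (t : SliceTwo F G) :
  SliceTwo (slice_comp1 H F) (slice_comp1 H G).
Proof.
refine (@Build_SliceTwo K X _ _ (slice_comp1 H F) (slice_comp1 H G)
  (wl (s1 H) (s2 t)) _).
abstract (apply: heq2_trans (heq2_sym (wl_comp1 _ _ _)) _;
  by rewrite s1_over; apply: s2_over).
Defined.

Definition slice_wr (S S' S'' : SliceOb X) (G H : SliceOne S' S'')
  (t : SliceTwo G H) (F : SliceOne S S') :
  SliceTwo (slice_comp1 G F) (slice_comp1 H F).
Proof.
refine (@Build_SliceTwo K X _ _ (slice_comp1 G F) (slice_comp1 H F)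
  (wr (s2 t) (s1 F)) _).
abstract (apply: heq2_trans (heq2_sym (wl_wr _ _ _)) _;
  apply: heq2_trans (heq2_wr _ (s2_over t)) _;
  by rewrite wr_id2 s1_over; apply: heq2_refl).
Defined.

Definition Slice : TwoCat.
Proof.
refine {| ob2 := SliceOb X; one := @SliceOne K X; two := @SliceTwo K X;
  id1 := slice_id1; comp1 := slice_comp1; id2 := slice_id2;
  vcomp := slice_vcomp; wl := slice_wl; wr := slice_wr |}.
- abstract (by move=> *; apply: slice1_ext; apply: comp1A).
- abstract (by move=> *; apply: slice1_ext; apply: comp1Il).
- abstract (by move=> *; apply: slice1_ext; apply: comp1Ir).
- abstract (by move=> *; apply: slice2_ext; apply: vcompA).
- abstract (by move=> *; apply: slice2_ext; apply: vcompIl).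
- abstract (by move=> *; apply: slice2_ext; apply: vcompIr).
- abstract (by move=> *; apply: slice2_ext; apply: wl_id2).
- abstract (by move=> *; apply: slice2_ext; apply: wl_vcomp).
- abstract (by move=> *; apply: slice2_ext; apply: wr_id2).
- abstract (by move=> *; apply: slice2_ext; apply: wr_vcomp).
- abstract (by move=> *; apply: slice_heq2; apply: wl_id1).
- abstract (by move=> *; apply: slice_heq2; apply: wl_comp1).
- abstract (by move=> *; apply: slice_heq2; apply: wr_id1).
- abstract (by move=> *; apply: slice_heq2; apply: wr_comp1).
- abstract (by move=> *; apply: slice_heq2; apply: wl_wr).
- abstract (by move=> *; apply: slice2_ext; apply: interchange).
Defined.
End Slice.

Record TwoMonad (K : TwoCat) := {
  M0 :> K -> K;
  M1 : forall A B, one A B -> one (M0 A) (M0 B);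
  M2 : forall A B (f g : one A B), two f g -> two (M1 f) (M1 g);
  M1_id : forall A, M1 (id1 A) = id1 (M0 A);
  M1_comp : forall A B C (g : one B C) (f : one A B),
    M1 (g ⋅ f) = M1 g ⋅ M1 f;
  M2_id : forall A B (f : one A B), M2 (id2 f) = id2 (M1 f);
  M2_vcomp : forall A B (f g h : one A B) (v : two g h) (u : two f g),
    M2 (vcomp v u) = vcomp (M2 v) (M2 u);
  M2_wl : forall A B C (h : one B C) (f g : one A B) (t : two f g),
    heq2 (M2 (wl h t)) (wl (M1 h) (M2 t));
  M2_wr : forall A B C (g h : one B C) (t : two g h) (f : one A B),
    heq2 (M2 (wr t f)) (wr (M2 t) (M1 f));
  Meta : forall A, one A (M0 A);
  Mgamma : forall A, one (M0 (M0 A)) (M0 A);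
  Meta1 : forall A B (f : one A B), Meta B ⋅ f = M1 f ⋅ Meta A;
  Meta2 : forall A B (f g : one A B) (t : two f g),
    heq2 (wl (Meta B) t) (wr (M2 t) (Meta A));
  Mgamma1 : forall A B (f : one A B),
    Mgamma B ⋅ M1 (M1 f) = M1 f ⋅ Mgamma A;
  Mgamma2 : forall A B (f g : one A B) (t : two f g),
    heq2 (wl (Mgamma B) (M2 (M2 t))) (wr (M2 t) (Mgamma A));
  Munit_l : forall A, Mgamma A ⋅ Meta (M0 A) = id1 (M0 A);
  Munit_r : forall A, Mgamma A ⋅ M1 (Meta A) = id1 (M0 A);
  Massoc : forall A, Mgamma A ⋅ M1 (Mgamma A) = Mgamma A ⋅ Mgamma (M0 A)
}.
Arguments M1 {K} t {A B} f : rename.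
Arguments M2 {K} t {A B f g} u : rename.
Arguments Meta {K} t A : rename.
Arguments Mgamma {K} t A : rename.

(* The identity 2-cell f => g when f = g is only a propositional equality. *)
Definition id2_of (K : TwoCat) (A B : K) (f g : one A B) (e : f = g) : two f g :=
  match e in _ = g' return two f g' with eq_refl => id2 f end.

Section PseudoAlgebra.
Variables (K : TwoCat) (M : TwoMonad K) (A : K) (a : one (M A) A).

Lemma pa_eq_unit_l :
  a ⋅ Meta M A ⋅ a = a ⋅ M1 M a ⋅ Meta M (M A).
Proof. by rewrite -!comp1A Meta1. Qed.

Lemma pa_eq_unit_r : a ⋅ M1 M (a ⋅ Meta M A) = a ⋅ M1 M a ⋅ M1 M (Meta M A).
Proof. by rewrite M1_comp comp1A. Qed.

Lemma pa_eq_assoc_l : a ⋅ Mgamma M A ⋅ M1 M (M1 M a)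
  = a ⋅ M1 M a ⋅ Mgamma M (M A).
Proof. by rewrite -!comp1A Mgamma1. Qed.

Lemma pa_eq_assoc_r : a ⋅ M1 M (a ⋅ Mgamma M A)
  = a ⋅ M1 M a ⋅ M1 M (Mgamma M A).
Proof. by rewrite M1_comp comp1A. Qed.
End PseudoAlgebra.

Record PseudoAlgebra (K : TwoCat) (M : TwoMonad K) (A : K) := {
  pa : one (M A) A;
  pzeta : two (id1 A) (pa ⋅ Meta M A);
  pzetaV : two (pa ⋅ Meta M A) (id1 A);
  ptheta : two (pa ⋅ M1 M pa) (pa ⋅ Mgamma M A);
  pthetaV : two (pa ⋅ Mgamma M A) (pa ⋅ M1 M pa);
  pzetaVK : vcomp pzetaV pzeta = id2 _;
  pzetaKV : vcomp pzeta pzetaV = id2 _;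
  pthetaVK : vcomp pthetaV ptheta = id2 _;
  pthetaKV : vcomp ptheta pthetaV = id2 _;
  punit_l : heq2 (vcomp (wr ptheta (Meta M (M A)))
      (vcomp (id2_of (pa_eq_unit_l pa)) (wr pzeta pa))) (id2 pa);
  punit_r : heq2 (vcomp (wr ptheta (M1 M (Meta M A)))
      (vcomp (id2_of (pa_eq_unit_r pa)) (wl pa (M2 M pzeta)))) (id2 pa);
  passoc :
    heq2 (vcomp (wr ptheta (Mgamma M (M A)))
           (vcomp (id2_of (pa_eq_assoc_l pa)) (wr ptheta (M1 M (M1 M pa)))))
         (vcomp (wr ptheta (M1 M (Mgamma M A)))
           (vcomp (id2_of (pa_eq_assoc_r pa)) (wl pa (M2 M ptheta))))
}.

Section Comma.
Variables (X Y : TangentCat) (P : Strong Y X).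

Record CommaOb := { cdom : X; ccod : Y; carr : hom cdom (P ccod) }.

Record CommaHom (x y : CommaOb) := {
  hdom : hom (cdom x) (cdom y);
  hcod : hom (ccod x) (ccod y);
  hcomm : fmap P hcod ∘ carr x = carr y ∘ hdom
}.

Lemma commahom_ext (x y : CommaOb) (f g : CommaHom x y) :
  hdom f = hdom g -> hcod f = hcod g -> f = g.
Proof.
case: f g => [f k c] [g l d] /= e e'; subst g l; by rewrite (pirr _ c d).
Qed.

Definition comma_id (x : CommaOb) : CommaHom x x.
Proof.
refine {| hdom := idc (cdom x); hcod := idc (ccod x) |}.
abstract (by rewrite fmap1 comp1f compf1).
Defined.

Definition comma_comp (x y w : CommaOb) (g : CommaHom y w) (f : CommaHom x y) :
  CommaHom x w.
Proof.
refine {| hdom := hdom g ∘ hdom f; hcod := hcod g ∘ hcod f |}.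
abstract (by rewrite fmapM -compA hcomm compA hcomm compA).
Defined.

Definition comma_cat : Cat.
Proof.
refine {| ob := CommaOb; hom := CommaHom; idc := comma_id; comp := comma_comp |}.
- abstract (by move=> *; apply: commahom_ext; apply: comp1f).
- abstract (by move=> *; apply: commahom_ext; apply: compf1).
- abstract (by move=> *; apply: commahom_ext; apply: compA).
Defined.

Definition comma_P1 : Functor comma_cat X.
Proof.
by refine {| fob (x : comma_cat) := cdom x;
  fmap (x y : comma_cat) (f : hom x y) := hdom f |}.
Defined.

Definition comma_P2 : Functor comma_cat Y.
Proof.
by refine {| fob (x : comma_cat) := ccod x;
  fmap (x y : comma_cat) (f : hom x y) := hcod f |}.
Defined.

Definition comma_Tob (x : CommaOb) : CommaOb :=
  {| cdom := T (cdom x); ccod := T (ccod x);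
     carr := saV P (ccod x) ∘ fmap tT (carr x) |}.

Definition comma_Thom (x y : CommaOb) (f : CommaHom x y) :
  CommaHom (comma_Tob x) (comma_Tob y).
Proof.
refine (@Build_CommaHom (comma_Tob x) (comma_Tob y) (fmap tT (hdom f)) (fmap tT (hcod f)) _).
abstract (by rewrite /= compA -saVN -!compA -!fmapM hcomm).
Defined.

Definition comma_T : Functor comma_cat comma_cat.
Proof.
refine (@Build_Functor comma_cat comma_cat comma_Tob comma_Thom _ _).
- abstract (by move=> x; apply: commahom_ext; apply: fmap1).
- abstract (by move=> *; apply: commahom_ext; apply: fmapM).
Defined.

Lemma comma_n_ex n (x : CommaOb) :
  exists! u : hom (tn n (cdom x)) (P (tn n (ccod x))),
    fmap P (tbase n (ccod x)) ∘ u = carr x ∘ tbase n (cdom x) /\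
    forall k, fmap P (tpr n k (ccod x)) ∘ u
              = carr (comma_Tob x) ∘ tpr n k (cdom x).
Proof.
apply: (proj2 (snfold P (ccod x) n)) => k /=.
have e : fmap P (tp (ccod x)) ∘ saV P (ccod x) = tp (P (ccod x)).
  by rewrite -sp -compA saKV compf1.
rewrite !compA e (tpN (tlaws X)) -compA; congr (_ ∘ _).
exact: (proj1 (ab_nfold (tadd (tlaws X) (cdom x)) n)).
Qed.

(* P preserves the n-fold pullbacks, so f : A -> P E induces T_n A -> P (T_n E). *)
Definition comma_n n (x : CommaOb) : CommaOb :=
  {| cdom := tn n (cdom x); ccod := tn n (ccod x);
     carr := proj1_sig (constructive_definite_description _ (comma_n_ex n x)) |}.

Lemma comma_nP n x :
  fmap P (tbase n (ccod x)) ∘ carr (comma_n n x) = carr x ∘ tbase n (cdom x) /\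
  forall k, fmap P (tpr n k (ccod x)) ∘ carr (comma_n n x)
            = carr (comma_Tob x) ∘ tpr n k (cdom x).
Proof.
exact: proj2_sig (constructive_definite_description _ (comma_n_ex n x)).
Qed.

Lemma comma_p_comm (x : CommaOb) :
  fmap P (tp (ccod x)) ∘ carr (comma_Tob x) = carr x ∘ tp (cdom x).
Proof.
by rewrite /= compA -(sp P) -(compA _ (sa P _)) saKV compf1 (tpN (tlaws X)).
Qed.

Definition comma_p (x : comma_cat) : hom (comma_T x) x :=
  @Build_CommaHom (comma_Tob x) x (tp (cdom x)) (tp (ccod x)) (comma_p_comm x).

Definition comma_base n (x : comma_cat) : @hom comma_cat (comma_n n x) x.
Proof.
refine (@Build_CommaHom (comma_n n x) x (tbase n (cdom x)) (tbase n (ccod x)) _).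
abstract (exact: (proj1 (comma_nP n x))).
Defined.

Definition comma_pr n (k : Fin.t n) (x : comma_cat) :
  @hom comma_cat (comma_n n x) (comma_T x).
Proof.
refine (@Build_CommaHom (comma_n n x) (comma_Tob x)
  (tpr n k (cdom x)) (tpr n k (ccod x)) _).
abstract (exact: (proj2 (comma_nP n x))).
Defined.

Lemma comma_z_comm (x : CommaOb) :
  fmap P (tz (ccod x)) ∘ carr x = carr (comma_Tob x) ∘ tz (cdom x).
Proof.
rewrite /= -compA -(tzN (tlaws X)) compA; congr (_ ∘ _).
exact: (iso_moveL (saVK P _)) (sz P _).
Qed.

Definition comma_z (x : comma_cat) : hom x (comma_T x) :=
  @Build_CommaHom x (comma_Tob x) (tz (cdom x)) (tz (ccod x)) (comma_z_comm x).

Lemma comma_s_comm (x : CommaOb) :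
  fmap P (ts (ccod x)) ∘ carr (comma_n 2 x) = carr (comma_Tob x) ∘ ts (cdom x).
Proof.
have [u [_ [_ [u1 [u2 u3]]]]] := strong_pair_di P (ccod x).
have [_ H] := comma_nP 2 x.
rewrite [carr (comma_Tob x)]/= -compA; apply: (iso_moveL (saVK P _)).
rewrite compA -u3 -compA; apply: (tsN (tlaws X)).
  by rewrite compA u1 -compA H /= compA compA saKV comp1f.
by rewrite compA u2 -compA H /= compA compA saKV comp1f.
Qed.

Definition comma_s (x : comma_cat) : @hom comma_cat (comma_n 2 x) (comma_T x) :=
  @Build_CommaHom (comma_n 2 x) (comma_Tob x)
  (ts (cdom x)) (ts (ccod x)) (comma_s_comm x).

Lemma comma_l_comm (x : CommaOb) :
  fmap P (tl (ccod x)) ∘ carr (comma_Tob x)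
  = carr (comma_Tob (comma_Tob x)) ∘ tl (cdom x).
Proof.
rewrite /= fmapM -!compA -(tlN (tlaws X)); apply: (iso_moveL (saVK P _)).
rewrite !compA; congr (_ ∘ _); rewrite -!compA.
have e : fmap tT (saV P (ccod x)) ∘ fmap tT (sa P (ccod x)) = idc _.
  by rewrite -fmapM saVK fmap1.
by apply: (iso_moveL e); rewrite !compA sl -compA saKV compf1.
Qed.

Definition comma_l (x : comma_cat) : hom (comma_T x) (comma_T (comma_T x)) :=
  @Build_CommaHom (comma_Tob x) (comma_Tob (comma_Tob x))
  (tl (cdom x)) (tl (ccod x)) (comma_l_comm x).

Lemma comma_c_comm (x : CommaOb) :
  fmap P (tc (ccod x)) ∘ carr (comma_Tob (comma_Tob x))
  = carr (comma_Tob (comma_Tob x)) ∘ tc (cdom x).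
Proof.
rewrite /= fmapM -!compA -(tcN (tlaws X)); apply: (iso_moveL (saVK P _)).
rewrite !compA; congr (_ ∘ _); rewrite -!compA.
have e : fmap tT (saV P (ccod x)) ∘ fmap tT (sa P (ccod x)) = idc _.
  by rewrite -fmapM saVK fmap1.
apply: (iso_moveL e); rewrite !compA -sc -!compA (compA (sa P _)) saKV comp1f.
by rewrite -fmapM saKV fmap1 compf1.
Qed.

Definition comma_c (x : comma_cat) :
  hom (comma_T (comma_T x)) (comma_T (comma_T x)) :=
  @Build_CommaHom (comma_Tob (comma_Tob x)) (comma_Tob (comma_Tob x))
  (tc (cdom x)) (tc (ccod x)) (comma_c_comm x).

Definition comma_data : TangentData :=
  {| tcat := comma_cat; tT := comma_T; tp := comma_p; tn := comma_n;
     tbase := comma_base; tpr := comma_pr; tz := comma_z; ts := comma_s;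
     tl := comma_l; tc := comma_c |}.

Lemma chom (x y : comma_cat) (f g : hom x y) :
  f = g -> hdom f = hdom g /\ hcod f = hcod g.
Proof. by move=> ->. Qed.

Lemma comma_wide (I : Type) (E B Q : comma_cat) (q : hom E B) (b : hom Q B)
    (pr : I -> hom Q E) :
  is_wide_pullback (hdom q) (hdom b) (fun i => hdom (pr i)) ->
  is_wide_pullback (hcod q) (hcod b) (fun i => hcod (pr i)) ->
  is_wide_pullback (fmap P (hcod q)) (fmap P (hcod b))
    (fun i => fmap P (hcod (pr i))) ->
  is_wide_pullback q b pr.
Proof.
move=> [c1 H1] [c2 H2] H3; split; first by move=> i; apply: commahom_ext; [apply: c1|apply: c2].
move=> W w y wy.
have [|u [[u1 u2] uu]] := H1 (cdom W) (hdom w) (fun i => hdom (y i)).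
  by move=> i; have [] := chom (wy i).
have [|v [[v1 v2] vv]] := H2 (ccod W) (hcod w) (fun i => hcod (y i)).
  by move=> i; have [] := chom (wy i).
have e : fmap P v ∘ carr W = carr Q ∘ u.
  apply: (wp_mono H3) => [|i]; rewrite !compA -fmapM.
    by rewrite v1 hcomm hcomm -compA u1.
  by rewrite v2 hcomm hcomm -compA u2.
exists (Build_CommaHom e : hom W Q); split.
  split; first by apply: commahom_ext.
  by move=> i; apply: commahom_ext; rewrite /= ?u2 ?v2.
move=> m [m1 m2]; have [a1 b1] := chom m1.
apply: commahom_ext => /=.
  by apply: uu; split=> // i; have [] := chom (m2 i).
by apply: vv; split=> // i; have [] := chom (m2 i).
Qed.

Lemma comma_nfold (b : bundle comma_cat) :
  has_nfold (bimg comma_P1 b) -> has_nfold (bimg comma_P2 b) ->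
  has_nfold (bimg P (bimg comma_P2 b)) -> has_nfold b.
Proof. by move=> h1 h2 h3 n; apply: comma_wide; [apply: h1|apply: h2|apply: h3]. Qed.

Lemma comma_iter m : forall b : bundle comma_cat,
  has_nfold (Nat.iter m (bimg tT) (bimg comma_P1 b)) ->
  has_nfold (Nat.iter m (bimg tT) (bimg comma_P2 b)) ->
  has_nfold (bimg P (Nat.iter m (bimg tT) (bimg comma_P2 b))) ->
  has_nfold (Nat.iter m (bimg comma_T) b).
Proof.
elim: m => [|m IH] b; first exact: comma_nfold.
by rewrite !PeanoNat.Nat.iter_succ_r => h1 h2 h3; apply: IH.
Qed.

Lemma P_iter m : forall b : bundle Y,
  has_nfold (Nat.iter m (bimg tT) (bimg P b)) ->
  has_nfold (bimg P (Nat.iter m (bimg tT) b)).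
Proof.
elim: m => [|m IH] b; first by [].
rewrite !PeanoNat.Nat.iter_succ_r => h; apply: IH; apply: di_nfold h.
apply: di_iter; exists (saV P _), (sa P _); split; first by split; rewrite (saKV, saVK).
exists (saV P _), (sa P _); split; first by split; rewrite (saKV, saVK).
split=> [|n]; first by rewrite /= saVN.
exists (saV P _), (sa P _); split; first by split; rewrite (saKV, saVK).
by split=> [|k] /=; rewrite saVN.
Qed.

Lemma comma_pullback (Q A B D : comma_cat) (f : hom A D) (g : hom B D)
    (pA : hom Q A) (pB : hom Q B) :
  is_pullback (hdom f) (hdom g) (hdom pA) (hdom pB) ->
  is_pullback (hcod f) (hcod g) (hcod pA) (hcod pB) ->
  is_pullback (fmap P (hcod f)) (fmap P (hcod g))
    (fmap P (hcod pA)) (fmap P (hcod pB)) ->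
  is_pullback f g pA pB.
Proof.
move=> [c1 H1] [c2 H2] [c3 H3]; split; first by apply: commahom_ext; [apply: c1|apply: c2].
move=> W a b ab; have [ab1 ab2] := chom ab.
have [u [[u1 u2] uu]] := H1 _ _ _ ab1.
have [v [[v1 v2] vv]] := H2 _ _ _ ab2.
have [|w [_ ww]] := H3 _ (carr A ∘ hdom a) (carr B ∘ hdom b).
  by rewrite !compA !hcomm -!compA; congr (_ ∘ _).
have e : fmap P v ∘ carr W = carr Q ∘ u.
  transitivity w; first symmetry; apply: ww.
    by rewrite !compA -!fmapM v1 v2 !hcomm.
  by rewrite !compA !hcomm -!compA u1 u2.
exists (Build_CommaHom e : hom W Q); split.
  by split; apply: commahom_ext.
move=> m [m1 m2]; have [a1 b1] := chom m1; have [a2 b2] := chom m2.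
by apply: commahom_ext; [apply: uu|apply: vv].
Qed.

Lemma comma_laws : tangent_laws comma_data.
Proof.
have LX := tlaws X; have LY := tlaws Y.
split.
- by move=> x y f; apply: commahom_ext; apply: tpN.
- by move=> x y f; apply: commahom_ext; apply: tzN.
- move=> x y f m /chom[a1 b1] /chom[a2 b2].
  by apply: commahom_ext; apply: tsN.
- by move=> x y f; apply: commahom_ext; apply: tlN.
- by move=> x y f; apply: commahom_ext; apply: tcN.
- move=> x; have AX := tadd LX (cdom x); have AY := tadd LY (ccod x); split.
  + apply: comma_nfold; [apply: (ab_nfold AX)|apply: (ab_nfold AY)|].
    exact: snfold.
  + by apply: commahom_ext; [apply: (ab_qz AX)|apply: (ab_qz AY)].
  + by apply: commahom_ext; [apply: (ab_qs AX)|apply: (ab_qs AY)].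
  + move=> u /chom[a1 b1] /chom[a2 b2].
    by apply: commahom_ext; [apply: (ab_unit AX)|apply: (ab_unit AY)].
  + move=> u /chom[a1 b1] /chom[a2 b2].
    by apply: commahom_ext; [apply: (ab_comm AX)|apply: (ab_comm AY)].
  + move=> pr k1 k2 k3 u12 u23 u v /chom[a1 b1] /chom[a2 b2] /chom[a3 b3]
      /chom[a4 b4] /chom[a5 b5] /chom[a6 b6] /chom[a7 b7] /chom[a8 b8].
    apply: commahom_ext.
      exact: (ab_assoc AX a1 a2 a3 a4 a5 a6 a7 a8).
    exact: (ab_assoc AY b1 b2 b3 b4 b5 b6 b7 b8).
- move=> m x; apply: comma_iter; [apply: (tpres LX)|apply: (tpres LY)|].
  apply: P_iter; apply: (di_nfold (b := Nat.iter m (bimg tT) (tbundle (P (ccod x))))).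
    by apply: di_iter; apply: di_sym; apply: strong_di.
  exact: (tpres LX).
- move=> x; have [a1 a2 a3] := tlB LX (cdom x); have [b1 b2 b3] := tlB LY (ccod x).
  split; [by apply: commahom_ext|by apply: commahom_ext|].
  move=> m /chom[c1 d1] /chom[c2 d2].
  by apply: commahom_ext; [apply: a3|apply: b3].
- move=> x; have [a1 a2 a3] := tcB LX (cdom x); have [b1 b2 b3] := tcB LY (ccod x).
  split; [by apply: commahom_ext|by apply: commahom_ext|].
  move=> m /chom[c1 d1] /chom[c2 d2].
  by apply: commahom_ext; [apply: a3|apply: b3].
- by move=> x; apply: commahom_ext; apply: tll.
- by move=> x; apply: commahom_ext; apply: tcc.
- by move=> x; apply: commahom_ext; apply: tccc.
- by move=> x; apply: commahom_ext; apply: tcl.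
- by move=> x; apply: commahom_ext; apply: tlc.
- move=> x u [/chom[a1 b1] /chom[a2 b2]]; apply: comma_pullback.
  + exact: (tvl LX (conj a1 a2)).
  + exact: (tvl LY (conj b1 b2)).
  + exact: (svl P (conj b1 b2)).
Qed.

Definition comma : TangentCat := {| tdata := comma_data; tlaws := comma_laws |}.

End Comma.

Lemma commaob_eq (X Y : TangentCat) (P : Strong Y X) (x y : CommaOb P) :
  cdom x = cdom y -> ccod x = ccod y -> heq (carr x) (carr y) -> x = y.
Proof.
case: x y => [A E f] [A' E' f'] /= eA eE; subst A' E' => /heq_eq e.
by subst f'.
Qed.

Lemma comma_heq (X Y : TangentCat) (P : Strong Y X) (x y x' y' : comma P)
    (f : hom x y) (f' : hom x' y') : x = x' -> y = y' ->
  heq (hdom f) (hdom f') -> heq (hcod f) (hcod f') -> heq f f'.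
Proof.
move=> ex ey; subst x' y' => /heq_eq e1 /heq_eq e2.
by apply: eq_heq; apply: commahom_ext.
Qed.

Lemma comma_ext (X Y Z : TangentCat) (P : Strong Y X) (G G' : Strong Z (comma P)) :
  (forall z, G z = G' z) ->
  (forall (A B : Z) (f : hom A B),
    heq (hdom (fmap G f)) (hdom (fmap G' f)) /\
    heq (hcod (fmap G f)) (hcod (fmap G' f))) ->
  (forall z, heq (hdom (sa G z)) (hdom (sa G' z)) /\
    heq (hcod (sa G z)) (hcod (sa G' z))) -> G = G'.
Proof.
move=> e h k; apply: strong_ext => // [A B f|z].
  by have [h1 h2] := h _ _ f; apply: comma_heq.
by have [h1 h2] := k z; apply: comma_heq; rewrite ?e.
Qed.

Definition comma_proj (X Y : TangentCat) (P : Strong Y X) : Strong (comma P) X.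
Proof.
refine (@Build_Strong (comma P) X (comma_P1 P) (fun x => idc _)
  (fun x => idc _) _ _ _ _ _ _ _ _).
- abstract (by move=> *; rewrite comp1f).
- abstract (by move=> *; rewrite comp1f).
- abstract (by move=> *; rewrite comp1f compf1).
- abstract (by move=> x; apply: bm_id; apply: (ab_nfold (tadd (tlaws X) (cdom x)))).
- abstract (by move=> x; rewrite /= fmap1 !comp1f compf1).
- abstract (by move=> x; rewrite /= fmap1 !comp1f !compf1).
- abstract (by move=> x; apply: (ab_nfold (tadd (tlaws X) (cdom x)))).
- abstract (by move=> x u [/chom[u1 _] /chom[u2 _]]; apply: (tvl (tlaws X) (conj u1 u2))).
Defined.

Definition comma_snd (X Y : TangentCat) (P : Strong Y X) : Strong (comma P) Y.
Proof.
refine (@Build_Strong (comma P) Y (comma_P2 P) (fun x => idc _)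
  (fun x => idc _) _ _ _ _ _ _ _ _).
- abstract (by move=> *; rewrite comp1f).
- abstract (by move=> *; rewrite comp1f).
- abstract (by move=> *; rewrite comp1f compf1).
- abstract (by move=> x; apply: bm_id; apply: (ab_nfold (tadd (tlaws Y) (ccod x)))).
- abstract (by move=> x; rewrite /= fmap1 !comp1f compf1).
- abstract (by move=> x; rewrite /= fmap1 !comp1f !compf1).
- abstract (by move=> x; apply: (ab_nfold (tadd (tlaws Y) (ccod x)))).
- abstract (by move=> x u [/chom[_ u1] /chom[_ u2]]; apply: (tvl (tlaws Y) (conj u1 u2))).
Defined.

(* The universal property of the comma object: a 2-cell g : G1 => P G2 induces
   the morphism Z -> X ↓ P sending z to g z : G1 z -> P (G2 z). *)
Section CommaInto.
Variables (X Y Z : TangentCat) (P : Strong Y X) (G1 : Strong Z X) (G2 : Strong Z Y)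
  (g : TangentTrans G1 (strong_comp P G2)).

Definition comma_into_ob (z : Z) : CommaOb P :=
  {| cdom := G1 z; ccod := G2 z; carr := g z |}.

Definition comma_into_hom (z w : Z) (f : hom z w) :
  CommaHom (comma_into_ob z) (comma_into_ob w).
Proof.
refine (@Build_CommaHom _ _ P (comma_into_ob z) (comma_into_ob w)
  (fmap G1 f) (fmap G2 f) _).
abstract (by symmetry; apply: (ntN g)).
Defined.

Definition comma_intoF : Functor Z (comma P).
Proof.
refine (@Build_Functor Z (comma P) comma_into_ob comma_into_hom _ _).
- abstract (by move=> z; apply: commahom_ext; apply: fmap1).
- abstract (by move=> *; apply: commahom_ext; apply: fmapM).
Defined.

Lemma comma_into_a_comm (z : Z) :
  fmap P (sa G2 z) ∘ carr (comma_into_ob (T z))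
  = carr (comma_Tob (comma_into_ob z)) ∘ sa G1 z.
Proof.
rewrite /= -compA; apply: (iso_moveL (saVK P _)).
by rewrite compA (ntT g).
Qed.

Definition comma_into_a (z : Z) : @hom (comma P) (comma_intoF (T z)) (T (comma_intoF z)) :=
  @Build_CommaHom _ _ P (comma_into_ob (T z)) (comma_Tob (comma_into_ob z))
  (sa G1 z) (sa G2 z) (comma_into_a_comm z).

Lemma comma_into_aV_comm (z : Z) :
  fmap P (saV G2 z) ∘ carr (comma_Tob (comma_into_ob z))
  = carr (comma_into_ob (T z)) ∘ saV G1 z.
Proof.
have e : fmap P (saV G2 z) ∘ fmap P (sa G2 z) = idc _.
  by rewrite -fmapM saVK fmap1.
symmetry; apply: (iso_moveL e); rewrite /= compA -[RHS]compf1 -(saKV G1 z) compA.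
congr (_ ∘ _); rewrite -compA; apply: (iso_moveL (saVK P _)).
by rewrite compA (ntT g).
Qed.

Definition comma_into_aV (z : Z) : @hom (comma P) (T (comma_intoF z)) (comma_intoF (T z)) :=
  @Build_CommaHom _ _ P (comma_Tob (comma_into_ob z)) (comma_into_ob (T z))
  (saV G1 z) (saV G2 z) (comma_into_aV_comm z).

Lemma comma_into_VK : forall z : Z, comma_into_aV z ∘ comma_into_a z = idc (comma_intoF (T z)).
Proof.
by move=> z; apply: commahom_ext; apply: saVK.
Qed.

Lemma comma_into_KV : forall z : Z, comma_into_a z ∘ comma_into_aV z = idc (T (comma_intoF z)).
Proof.
by move=> z; apply: commahom_ext; apply: saKV.
Qed.

Lemma comma_into_N : forall (z w : Z) (f : hom z w),
  comma_into_a w ∘ fmap comma_intoF (fmap tT f)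
  = fmap tT (fmap comma_intoF f) ∘ comma_into_a z.
Proof.
by move=> z w f; apply: commahom_ext; apply: saN.
Qed.

Lemma comma_into_B : forall z : Z,
  @bundle_morphism (comma P) (bimg comma_intoF (tbundle z))
    (tbundle (comma_intoF z)) (idc (comma_intoF z)) (comma_into_a z).
Proof.
move=> z; have [a1 a2 a3] := sB G1 z; have [b1 b2 b3] := sB G2 z.
split; [by apply: commahom_ext|by apply: commahom_ext|].
move=> m /chom[c1 d1] /chom[c2 d2].
by apply: commahom_ext; [apply: a3|apply: b3].
Qed.

Lemma comma_into_l : forall z : Z,
  fmap tT (comma_into_a z) ∘ comma_into_a (T z) ∘ fmap comma_intoF (tl z)
  = tl (comma_intoF z) ∘ comma_into_a z.
Proof.
by move=> z; apply: commahom_ext; apply: sl.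
Qed.

Lemma comma_into_c : forall z : Z,
  tc (comma_intoF z) ∘ fmap tT (comma_into_a z) ∘ comma_into_a (T z)
  = fmap tT (comma_into_a z) ∘ comma_into_a (T z) ∘ fmap comma_intoF (tc z).
Proof.
by move=> z; apply: commahom_ext; apply: sc.
Qed.

Lemma comma_into_nfold : forall z : Z, has_nfold (bimg comma_intoF (tbundle z)).
Proof.
move=> z; apply: comma_nfold.
+ exact: (snfold G1).
+ exact: (snfold G2).
+ exact: (snfold (strong_comp P G2)).
Qed.

Lemma comma_into_vl : forall (z : Z) u, is_lift_pairing u ->
  is_pullback (fmap comma_intoF (fmap tT (tp z))) (fmap comma_intoF (tz z))
    (fmap comma_intoF (fmap tT (ts z) ∘ u)) (fmap comma_intoF (tp z ∘ tpr1 z)).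
Proof.
move=> z u H; apply: comma_pullback.
+ exact: (svl G1 H).
+ exact: (svl G2 H).
+ exact: (svl (strong_comp P G2) H).
Qed.

Definition comma_into : Strong Z (comma P) :=
  @Build_Strong Z (comma P) comma_intoF comma_into_a comma_into_aV
    comma_into_VK comma_into_KV comma_into_N comma_into_B comma_into_l
    comma_into_c comma_into_nfold comma_into_vl.
End CommaInto.

Definition castcod (C : Cat) (A B B' : C) (e : B = B') (f : hom A B) : hom A B' :=
  match e in _ = B' return hom A B' with eq_refl => f end.

Lemma castcod_heq (C : Cat) (A B B' : C) (e : B = B') (f : hom A B) :
  heq (castcod e f) f.
Proof. by case: _ / e; apply: heq_refl. Qed.

(* P E = Q (F E) when Q F = P. *)
Definition over_ob (X Y Y' : TangentCat) (P : Strong Y X) (Q : Strong Y' X)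
    (F : Strong Y Y') (e : strong_comp Q F = P) (E : Y) : P E = Q (F E) :=
  match e in _ = P return P E = Q (F E) with eq_refl => eq_refl end.

Section CommaMap.
Variables (X Y Y' : TangentCat) (P : Strong Y X) (Q : Strong Y' X).

Definition comma_map_cell (F : Strong Y Y') (e : strong_comp Q F = P) :
  TangentTrans (comma_proj P) (strong_comp Q (strong_comp F (comma_snd P))).
Proof.
refine (@Build_TangentTrans _ _ (comma_proj P)
  (strong_comp Q (strong_comp F (comma_snd P)))
  (fun x : comma P => castcod (over_ob e (ccod x)) (carr x)) _ _).
- abstract (by case: _ / e => x y f /=; rewrite -hcomm).
- abstract (case: _ / e => x /=; rewrite !fmap1 !compf1 !compA;
  by rewrite -(compA (sa Q _)) -fmapM saKV fmap1 compf1 saKV comp1f).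
Defined.

(* The functor X ↓ P -> X ↓ Q sending f : A -> P E to f : A -> P E = Q (F E). *)
Definition comma_map (F : Strong Y Y') (e : strong_comp Q F = P) :
  Strong (comma P) (comma Q) := comma_into (comma_map_cell e).

Lemma comma_map2_comm (F G : Strong Y Y') (e : strong_comp Q F = P)
  (e' : strong_comp Q G = P) (t : TangentTrans F G)
  (et : forall E, heq (fmap Q (t E)) (idc (P E))) (x : comma P) :
  fmap Q (t (ccod x)) ∘ carr (comma_map e x)
  = carr (comma_map e' x) ∘ idc (cdom x).
Proof.
apply: heq_eq; rewrite compf1.
apply: heq_trans (heq_comp (et (ccod x)) (castcod_heq _ _)) _.
by rewrite comp1f; apply: heq_sym; apply: castcod_heq.
Qed.

Definition comma_map2 (F G : Strong Y Y') (e : strong_comp Q F = P)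
  (e' : strong_comp Q G = P) (t : TangentTrans F G)
  (et : forall E, heq (fmap Q (t E)) (idc (P E))) :
  TangentTrans (comma_map e) (comma_map e').
Proof.
refine (@Build_TangentTrans _ _ (comma_map e) (comma_map e')
  (fun x => @Build_CommaHom _ _ Q (comma_map e x) (comma_map e' x)
    (idc (cdom x)) (t (ccod x)) (comma_map2_comm e e' et x)) _ _).
- abstract (move=> x y f; apply: commahom_ext => /=;
  [by rewrite comp1f compf1|exact: ntN]).
- abstract (move=> x; apply: commahom_ext => /=;
  [by rewrite fmap1|by rewrite !fmap1 !compf1 ntT]).
Defined.
End CommaMap.

Definition comma_unit_cell (X Y : TangentCat) (P : Strong Y X) :
  TangentTrans P (strong_comp P (strong_id Y)).
Proof.
refine (@Build_TangentTrans _ _ P (strong_comp P (strong_id Y))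
  (fun E => idc (P E)) _ _).
- abstract (by move=> *; rewrite comp1f compf1).
- abstract (by move=> E /=; rewrite !fmap1 !compf1 comp1f).
Defined.

Definition comma_unit (X Y : TangentCat) (P : Strong Y X) : Strong Y (comma P) :=
  comma_into (comma_unit_cell P).

Definition comma_mul_cell (X Y : TangentCat) (P : Strong Y X) :
  TangentTrans (comma_proj (comma_proj P))
    (strong_comp P (strong_comp (comma_snd P) (comma_snd (comma_proj P)))).
Proof.
refine (@Build_TangentTrans _ _ (comma_proj (comma_proj P))
  (strong_comp P (strong_comp (comma_snd P) (comma_snd (comma_proj P))))
  (fun w : comma (comma_proj P) => carr (ccod w) ∘ carr w) _ _).
- abstract (by move=> w w' f /=; rewrite -compA -hcomm /= compA -hcomm compA).
- abstract (by move=> w /=; rewrite !comp1f fmap1 !compf1 fmapM !compA saKV comp1f).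
Defined.

Definition comma_mul (X Y : TangentCat) (P : Strong Y X) :
  Strong (comma (comma_proj P)) (comma P) := comma_into (comma_mul_cell P).

Section StreetMonad.
Variable X : TangentCat.
Let K := Slice (X : TngCat).

Definition street_ob (S : K) : K :=
  {| sob := comma (smap S) : TngCat; smap := comma_proj (smap S) |}.

Definition street_one (S S' : K) (F : one S S') : one (street_ob S) (street_ob S').
Proof.
refine (@Build_SliceOne TngCat X (street_ob S) (street_ob S')
  (comma_map (s1_over F)) _).
abstract (apply: strong_ext => [x|x y f|x] /=; [by []|exact: heq_refl|];
  by apply: eq_heq; rewrite comp1f).
Defined.

Lemma over_id (S S' : K) (F G : one S S') (t : two F G) (E : sob S : TangentCat) :
  heq (fmap (smap S' : Strong _ _) ((s2 t : TangentTrans _ _) E))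
      (idc ((smap S : Strong _ _) E)).
Proof.
have H (F1 G1 F2 G2 : Strong (sob S) X) (u : TangentTrans F1 G1)
    (v : TangentTrans F2 G2) : @heq2 TangentCat Strong TangentTrans _ _ _ _ u _ _ v ->
    heq (u E) (v E) by case; apply: heq_refl.
exact: (H _ _ _ _ _ _ (s2_over t)).
Qed.

Definition street_two (S S' : K) (F G : one S S') (t : two F G) :
  two (street_one F) (street_one G).
Proof.
refine (@Build_SliceTwo TngCat X _ _ (street_one F) (street_one G)
  (comma_map2 (s1_over F) (s1_over G) (over_id t)) _).
abstract (apply: trans_heq2; try exact: (s1_over (street_one _));
  by move=> x; apply: heq_refl).
Defined.

Definition street_eta (S : K) : one S (street_ob S).
Proof.
refine (@Build_SliceOne TngCat X S (street_ob S) (comma_unit (smap S)) _).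
abstract (apply: strong_ext => [E|A B f|E] /=; [by []|exact: heq_refl|];
  by apply: eq_heq; rewrite comp1f).
Defined.

Definition street_gamma (S : K) : one (street_ob (street_ob S)) (street_ob S).
Proof.
refine (@Build_SliceOne TngCat X (street_ob (street_ob S)) (street_ob S)
  (comma_mul (smap S)) _).
abstract (apply: strong_ext => [E|A B f|E] /=; [by []|exact: heq_refl|];
  by apply: eq_heq; rewrite comp1f).
Defined.

Lemma street_one_id (S : K) : street_one (id1 S) = id1 (street_ob S).
Proof.
apply: slice1_ext; apply: comma_ext => [x|x y f|x] /=.
- by apply: commaob_eq => //=; apply: castcod_heq.
- by split; apply: heq_refl.
- by split; apply: eq_heq; rewrite ?comp1f.
Qed.

Lemma street_one_comp (S S' S'' : K) (G : one S' S'') (F : one S S') :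
  street_one (G ⋅ F) = street_one G ⋅ street_one F.
Proof.
apply: slice1_ext; apply: comma_ext => [x|x y f|x] /=.
- apply: commaob_eq => //=; apply: heq_trans (castcod_heq _ _) _.
  by apply: heq_sym; apply: heq_trans (castcod_heq _ _) (castcod_heq _ _).
- by split; apply: heq_refl.
- split; apply: eq_heq; rewrite ?comp1f ?fmap1 ?compf1 //.
Qed.

Lemma street_heq2 (S S' : K) (F F' G G' : one S (street_ob S'))
  (t : two F G) (t' : two F' G') : F = F' -> G = G' ->
  (forall E : sob S : TangentCat,
    heq (hdom ((s2 t : TangentTrans _ _) E)) (hdom ((s2 t' : TangentTrans _ _) E)) /\
    heq (hcod ((s2 t : TangentTrans _ _) E)) (hcod ((s2 t' : TangentTrans _ _) E))) ->
  heq2 t t'.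
Proof.
move=> e e' H; subst F' G'; apply: slice_heq2; apply: trans_heq2 => // E.
by have [h1 h2] := H E; apply: comma_heq.
Qed.

Lemma strong_eq (Y Z : TangentCat) (F G : Strong Y Z) : F = G ->
  (forall A, F A = G A) /\
  (forall (A B : Y) (f : hom A B), heq (fmap F f) (fmap G f)) /\
  (forall A, heq (sa F A) (sa G A)).
Proof. by move=> ->; do !split=> *; try exact: heq_refl. Qed.

Lemma street_eta1 (S S' : K) (F : one S S') :
  street_eta S' ⋅ F = street_one F ⋅ street_eta S.
Proof.
have [e1 [e2 e3]] := strong_eq (s1_over F).
apply: slice1_ext; apply: comma_ext => [E|E E' f|E] /=.
- apply: commaob_eq => //=; first exact: e1.
  apply: heq_sym; apply: heq_trans (castcod_heq _ _) _; apply: heq_idc.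
  by symmetry; apply: e1.
- split; [exact: e2|exact: heq_refl].
- split; first by rewrite comp1f; apply: e3.
  by apply: eq_heq; rewrite comp1f !fmap1 !compf1.
Qed.

Lemma street_gamma1 (S S' : K) (F : one S S') :
  street_gamma S' ⋅ street_one (street_one F) = street_one F ⋅ street_gamma S.
Proof.
apply: slice1_ext; apply: comma_ext => [E|E E' f|E] /=.
- apply: commaob_eq => //=.
  apply: heq_sym; apply: heq_trans (castcod_heq _ _) _.
  by apply: heq_comp; apply: heq_sym; apply: castcod_heq.
- by split; apply: heq_refl.
- by split; apply: eq_heq; rewrite ?comp1f ?fmap1 ?compf1 ?comp1f.
Qed.

Lemma street_unit_l (S : K) :
  street_gamma S ⋅ street_eta (street_ob S) = id1 (street_ob S).
Proof.
apply: slice1_ext; apply: comma_ext => [x|x y f|x] /=.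
- by apply: commaob_eq => //=; apply: eq_heq; rewrite compf1.
- by split; apply: heq_refl.
- by split; apply: eq_heq; rewrite ?comp1f.
Qed.

Lemma street_unit_r (S : K) :
  street_gamma S ⋅ street_one (street_eta S) = id1 (street_ob S).
Proof.
apply: slice1_ext; apply: comma_ext => [x|x y f|x] /=.
- apply: commaob_eq => //=.
  apply: heq_trans (heq_comp (heq_refl _) (castcod_heq _ _)) _.
  by rewrite comp1f; apply: heq_refl.
- by split; apply: heq_refl.
- by split; apply: eq_heq; rewrite ?comp1f.
Qed.

Lemma street_assoc (S : K) : street_gamma S ⋅ street_one (street_gamma S)
  = street_gamma S ⋅ street_gamma (street_ob S).
Proof.
apply: slice1_ext; apply: comma_ext => [x|x y f|x] /=.
- apply: commaob_eq => //=.
  apply: heq_trans (heq_comp (heq_refl _) (castcod_heq _ _)) _.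
  by apply: eq_heq; rewrite compA.
- by split; apply: heq_refl.
- by split; apply: eq_heq; rewrite ?comp1f.
Qed.

Definition street_monad : TwoMonad K.
Proof.
refine {| M0 := street_ob; M1 := street_one; M2 := street_two;
  Meta := street_eta; Mgamma := street_gamma;
  M1_id := street_one_id; M1_comp := street_one_comp;
  Meta1 := street_eta1; Mgamma1 := street_gamma1; Munit_l := street_unit_l;
  Munit_r := street_unit_r; Massoc := street_assoc |}.
- abstract (move=> S S' F; apply: slice2_ext; apply: trans_ext => x /=;
  exact: commahom_ext).
- abstract (move=> S S' F G H v u; apply: slice2_ext; apply: trans_ext => x /=;
  by apply: commahom_ext; rewrite //= comp1f).
- abstract (move=> S S' S'' H F G t; apply: street_heq2; try exact: street_one_comp;
  by move=> x; split; apply: heq_refl).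
- abstract (move=> S S' S'' G H t F; apply: street_heq2; try exact: street_one_comp;
  by move=> x; split; apply: heq_refl).
- abstract (move=> S S' F G t; apply: street_heq2; try exact: street_eta1;
  move=> x; split; last exact: heq_refl;
  exact: over_id).
- abstract (move=> S S' F G t; apply: street_heq2; try exact: street_gamma1;
  by move=> x; split; apply: heq_refl).
Defined.

End StreetMonad.

Definition is_cartesian (C D : Cat) (P : Functor C D) (E' E : C) (phi : hom E' E)
    : Prop :=
  forall (W : C) (psi : hom W E) (h : hom (P W) (P E')),
    fmap P phi ∘ h = fmap P psi ->
    exists! xi : hom W E', fmap P xi = h /\ phi ∘ xi = psi.

Record Lift (C : Cat) (E : C) := { ldom : C; lmap : hom ldom E }.
Arguments ldom {C E} l.
Arguments lmap {C E} l.

Definition Cleavage (C D : Cat) (P : Functor C D) :=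
  forall (A : D) (E : C), hom A (P E) -> Lift E.

Definition is_cloven (C D : Cat) (P : Functor C D) (c : Cleavage P) : Prop :=
  forall (A : D) (E : C) (f : hom A (P E)),
    heq (fmap P (lmap (c A E f))) f /\ is_cartesian P (lmap (c A E f)).

Record is_tangent_fibration (Y X : TangentCat) (P : Strong Y X) (c : Cleavage P)
    : Prop := {
  tf_strict : is_strict P;
  tf_cloven : is_cloven c;
  (* As P is strict, [saV P E ∘ fmap tT f] is T f, seen as a morphism to P (T E). *)
  tf_kappa : forall (A : X) (E : Y) (f : hom A (P E)),
    let l := c A E f in
    let Tl := c (T A) (T E) (saV P E ∘ fmap tT f) in
    exists kappa : hom (T (ldom l)) (ldom Tl),
      heq (fmap P kappa) (idc (T A)) /\
      lmap Tl ∘ kappa = fmap tT (lmap l) /\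
      is_iso kappa
}.

Section CleavageOf.
Variables (X : TangentCat) (S : Slice (X : TngCat))
  (H : PseudoAlgebra (street_monad X) S).

Definition alg_map : Strong (comma (smap S)) (sob S) := s1 (pa H).

Definition alg_zetaV (E : (sob S : TangentCat)) :
    hom (alg_map (comma_unit (smap S) E)) E :=
  (s2 (pzetaV H) : TangentTrans _ _) E.

(* f : A -> P E, as a morphism to id : P E -> P E in X ↓ P. *)
Definition to_unit (A : X) (E : (sob S : TangentCat))
    (f : hom A ((smap S : Strong _ _) E)) :
  @hom (comma (smap S)) {| cdom := A; ccod := E; carr := f |}
    (comma_unit (smap S) E).
Proof.
refine (@Build_CommaHom _ _ _ {| cdom := A; ccod := E; carr := f |}
  (comma_unit (smap S) E) f (idc E) _).
abstract (by rewrite /= fmap1).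
Defined.

(* Street: f^*E is a (f : A -> P E), and its lift to E is
   a (f : A -> P E) -> a (id : P E -> P E) ≅ E. *)
Definition cleavage_of : Cleavage (smap S : Strong _ _) :=
  fun A E f =>
    {| ldom := alg_map {| cdom := A; ccod := E; carr := f |};
       lmap := alg_zetaV E ∘ fmap alg_map (to_unit f) |}.
End CleavageOf.

(* Main.v *)
(** Write [a x -> E] for the chosen lift of [x = (f : A -> P E)]. A map into [a x]
    is the same as a compatible pair of its image under [P] and its composite with
    the lift, so [a] is right adjoint to the unit [E |-> id_{P E}], and every piece
    of algebra structure on [a] is forced by its two images. From a tangent
    fibration one obtains in this way the action on morphisms, [zeta] and [theta];
    the structure map [a T => T a] is the inverse of [kappa], and [a] preserves the
    required pullbacks because it is a right adjoint. Conversely, for a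
    pseudoalgebra the triangle identity of that adjunction follows from both unit
    laws and naturality of [theta]; hence the lifts are cartesian, and the inverse
    of the structure map of [a] is [kappa]. *)
From Corelib Require Import ssreflect.
From Stdlib Require Import Description FunctionalExtensionality.
Require Import Defs.
Set Implicit Arguments.
Unset Strict Implicit.
Unset Printing Implicit Defensive.
Set Bullet Behavior "None".

(** * Heterogeneous equality with identities, and morphisms out of unit objects *)

(** A hypothesis [heq m (idc A)] expresses that [m] is an identity although its end points equal [A]
    only propositionally; [P] sends many structure maps to such morphisms. Such an [m] can be erased
    from a composite without casts. *)
Lemma heq_idl (C : Cat) (A B D E : C) (m : hom B D) (f : hom E B) :
  heq m (idc A) -> heq (m ∘ f) f.
Proof.
move=> h; have [eB eD] := heq_dom h; subst B D.
by rewrite (heq_eq h) comp1f; apply: heq_refl.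
Qed.

Lemma heq_idr (C : Cat) (A B D E : C) (m : hom B D) (f : hom D E) :
  heq m (idc A) -> heq (f ∘ m) f.
Proof.
move=> h; have [eB eD] := heq_dom h; subst B D.
by rewrite (heq_eq h) compf1; apply: heq_refl.
Qed.

Lemma heq_id_self (C : Cat) (A B D : C) (m : hom B D) :
  heq m (idc A) -> heq m (idc B).
Proof. by move=> h; have [e _] := heq_dom h; subst A. Qed.

Lemma heq_cancel_id (C : Cat) (A B D E : C) (f : hom E B) (g : hom B D) :
  heq (g ∘ f) (idc A) -> heq f (idc A) -> heq g (idc A).
Proof. by move=> h hf; apply: heq_trans (heq_sym (heq_idr g hf)) h. Qed.

Lemma heq_cast (C : Cat) (A B A' B' : C) (h : hom A B) :
  A = A' -> B = B' -> exists h' : hom A' B', heq h' h.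
Proof. by move=> <- <-; exists h; apply: heq_refl. Qed.

Lemma heq_hdom (X Y : TangentCat) (P : Strong Y X) (x y x' y' : comma P)
    (f : hom x y) (g : hom x' y') : heq f g -> heq (hdom f) (hdom g).
Proof. exact: (heq_fmap (comma_P1 P)). Qed.

Lemma heq_hcod (X Y : TangentCat) (P : Strong Y X) (x y x' y' : comma P)
    (f : hom x y) (g : hom x' y') : heq f g -> heq (hcod f) (hcod g).
Proof. exact: (heq_fmap (comma_P2 P)). Qed.

(** Transposition for the adjunction with [comma_unit P] on the left. The domain [B] of [h] is left
    free, since in applications it equals [P W] only propositionally. *)
Lemma unit_hom_ex (X Y : TangentCat) (P : Strong Y X) (x : comma P) (W : Y)
    (k : hom W (ccod x)) (B : X) (h : hom B (cdom x)) :
  heq (fmap P k) (carr x ∘ h) ->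
  exists u : hom (comma_unit P W) x, heq (hdom u) h /\ hcod u = k.
Proof.
move=> e; have [eB _] := heq_dom e; subst B.
have c : fmap P k ∘ carr (comma_unit P W) = carr x ∘ h.
  by rewrite /= compf1; exact: heq_eq.
by exists (@Build_CommaHom _ _ P (comma_unit P W) x h k c); split=> //; apply: heq_refl.
Qed.

(** * Components of 2-cells in the slice *)

Section SliceCells.
Variables (X : TangentCat) (S1 S2 : Slice (X : TngCat)).

Definition cell (F G : one S1 S2) (t : two F G) :
  TangentTrans (s1 F : Strong (sob S1) (sob S2)) (s1 G : Strong _ _) := s2 t.

Lemma slice_two_heq (F G F' G' : one S1 S2) (t : two F G) (t' : two F' G') :
  heq2 t t' -> forall E : (sob S1 : TangentCat),
  heq (cell t E) (cell t' E).
Proof. by case=> E; apply: heq_refl. Qed.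

(** The mediating 2-cells in the pseudoalgebra axioms have identity components up to [heq], so they
    can be erased when the axioms are read componentwise. *)
Lemma id2_of_heq (F G : one S1 S2) (e : F = G) (E : (sob S1 : TangentCat)) :
  heq (cell (id2_of e) E) (idc ((s1 F : Strong _ _) E)).
Proof. by case: _ / e; apply: heq_refl. Qed.
End SliceCells.

(** * From a pseudoalgebra to a tangent fibration *)

Section Algebra.
Variables (X Y : TangentCat) (P : Strong Y X).
Local Notation S := (@Build_SliceOb TngCat X Y P).
Variable H : PseudoAlgebra (street_monad X) S.
Local Notation a := (alg_map H).

(** An equality of strong morphisms; the next three lemmas extract its parts on objects, on
    morphisms and on structure maps. *)
Lemma alg_over : strong_comp P a = comma_proj P.
Proof. exact: (s1_over (pa H)). Qed.

Lemma alg_ob (x : comma P) : P (a x) = cdom x.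
Proof. exact: (proj1 (strong_eq alg_over) x). Qed.

Lemma alg_hom (x y : comma P) (u : hom x y) : heq (fmap P (fmap a u)) (hdom u).
Proof. exact: (proj1 (proj2 (strong_eq alg_over)) x y u). Qed.

Lemma alg_sa (x : comma P) :
  heq (sa P (a x) ∘ fmap P (sa a x)) (idc (T (cdom x))).
Proof. exact: (proj2 (proj2 (strong_eq alg_over)) x). Qed.

Definition alg_zeta_cell : TangentTrans (strong_id Y) (strong_comp a (comma_unit P)) :=
  s2 (pzeta H).
Definition alg_zetaV_cell : TangentTrans (strong_comp a (comma_unit P)) (strong_id Y) :=
  s2 (pzetaV H).
Local Notation e := (s1_over (pa H)).
Definition alg_theta_cell :
  TangentTrans (strong_comp a (comma_map e)) (strong_comp a (comma_mul P)) :=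
  s2 (ptheta H).

Lemma alg_zetaVK (E : Y) : alg_zetaV_cell E ∘ alg_zeta_cell E = idc E.
Proof.
have := f_equal (fun t => @cell X S S _ _ t E) (pzetaVK H); done.
Qed.

Lemma alg_zetaKV (E : Y) : alg_zeta_cell E ∘ alg_zetaV_cell E = idc _.
Proof.
have := f_equal (fun t => @cell X S S _ _ t E) (pzetaKV H); done.
Qed.

Lemma alg_over_zeta (E : Y) : heq (fmap P (alg_zeta_cell E)) (idc (P E)).
Proof. exact: (over_id (pzeta H)). Qed.

Lemma alg_over_zetaV (E : Y) : heq (fmap P (alg_zetaV_cell E)) (idc (P E)).
Proof.
exact: (over_id (pzetaV H) E).
Qed.

Lemma alg_over_theta (w : comma (comma_proj P)) :
  heq (fmap P (alg_theta_cell w)) (idc (cdom w)).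
Proof. exact: (over_id (ptheta H) w). Qed.

(** The left unit law at [x]. The mediating component is hidden behind [m], of which only its being
    an identity is needed. *)
Lemma alg_unit_l (x : comma P) :
  exists m : hom (a (comma_unit P (a x)))
    (a (comma_map e (comma_unit (comma_proj P) x))),
  heq m (idc (a (comma_unit P (a x)))) /\
  heq (alg_theta_cell (comma_unit (comma_proj P) x) ∘ (m ∘ alg_zeta_cell (a x))) (idc (a x)).
Proof.
have h := slice_two_heq (punit_l H) x.
exists (cell (id2_of (pa_eq_unit_l (pa H))) x); split; last exact: h.
exact: (id2_of_heq (pa_eq_unit_l (pa H)) x).
Qed.

Lemma alg_unit_r (x : comma P) :
  exists m : hom (a (comma_map (s1_over (pa H ⋅ Meta (street_monad X) S)) x))
    (a (comma_map e (comma_map (s1_over (street_eta S)) x))),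
  heq m (idc (a (comma_map (s1_over (pa H ⋅ Meta (street_monad X) S)) x))) /\
  heq (alg_theta_cell (comma_map (s1_over (street_eta S)) x) ∘
     (m ∘ fmap a (cell (street_two (pzeta H)) x))) (idc (a x)).
Proof.
have h := slice_two_heq (punit_r H) x.
exists (cell (id2_of (pa_eq_unit_r (pa H))) x); split; last exact: h.
exact: (id2_of_heq (pa_eq_unit_r (pa H)) x).
Qed.

(** This is the unit of the adjunction in which [comma_snd P] is left adjoint to [comma_unit P]. *)
Definition to_eta (x : comma P) : hom x (comma_unit P (ccod x)) :=
  @to_unit X S (cdom x) (ccod x) (carr x).

(** The lift chosen by [cleavage_of], indexed by objects of the comma category so that it becomes a
    natural transformation from [a] to [comma_snd P]. *)
Definition alg_lift (x : comma P) : hom (a x) (ccod x) :=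
  alg_zetaV_cell (ccod x) ∘ fmap a (to_eta x).

Lemma alg_lift_nat (x y : comma P) (u : hom x y) :
  alg_lift y ∘ fmap a u = hcod u ∘ alg_lift x.
Proof.
rewrite /alg_lift /= -compA -fmapM compA -(ntN alg_zetaV_cell) /= -compA -fmapM.
congr (_ ∘ fmap a _); apply: commahom_ext => /=.
  by rewrite hcomm.
by rewrite comp1f compf1.
Qed.

Lemma alg_over_lift (x : comma P) : heq (fmap P (alg_lift x)) (carr x).
Proof.
rewrite /alg_lift /= fmapM.
apply: heq_trans (alg_hom (to_eta x)).
exact: heq_idl (alg_over_zetaV _).
Qed.

(* Naturality along [(id, x) -> (x, id)] moves [theta] to a place where the right
   unit law identifies it with the image of [zeta]'s inverse. *)
Lemma alg_theta_unit (x : comma P) (u : hom (comma_unit P (a x)) x) :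
  heq (hdom u) (idc (cdom x)) -> hcod u = alg_lift x ->
  heq (alg_theta_cell (comma_unit (comma_proj P) x)) (fmap a u).
Proof.
move=> u1 u2.
have [m [hm h]] := alg_unit_r x.
(* Commutation for [v], the morphism from [(id, x)] to [(x, id)] that is the identity on [cdom x]
   and [to_eta x] on the other side. *)
have vc : fmap (comma_proj P) (to_eta x) ∘ carr (comma_unit (comma_proj P) x)
  = carr (comma_map (s1_over (street_eta S)) x) ∘ idc (cdom x).
  rewrite /= !compf1; apply: heq_eq; apply: heq_sym; exact: castcod_heq.
pose v : hom (comma_unit (comma_proj P) x) (comma_map (s1_over (street_eta S)) x) :=
  @Build_CommaHom _ _ (comma_proj P) (comma_unit (comma_proj P) x)
    (comma_map (s1_over (street_eta S)) x) (idc (cdom x)) (to_eta x) vc.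
have N := ntN alg_theta_cell v.
(* Multiplication sends both ends of [v] to [x], and [v] to the identity, so naturality expresses
   the wanted component of [theta] by the one at the target of [v]. *)
have g1 : heq (fmap a (fmap (comma_mul P) v)) (idc (a x)).
  rewrite -fmap1; apply: heq_fmap; apply: comma_heq => /=; try exact: heq_refl.
  - by apply: commaob_eq => //=; apply: eq_heq; rewrite compf1.
  - apply: commaob_eq => //=.
    by apply: heq_trans (heq_idl _ (heq_refl _)) (castcod_heq _ _).
apply: heq_trans (heq_sym (heq_idl (alg_theta_cell (comma_unit (comma_proj P) x)) g1)) _.
have N' : fmap a (fmap (comma_mul P) v) ∘ alg_theta_cell (comma_unit (comma_proj P) x)
  = alg_theta_cell (comma_map (s1_over (street_eta S)) x) ∘ fmap a (fmap (comma_map e) v).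
  by symmetry; exact: N.
rewrite N'.
(* [MzV] is the image under the monad of the inverse of [zeta], retyped to end in [x] itself. *)
have zc : fmap P (alg_zetaV_cell (ccod x)) ∘
   carr (comma_map (s1_over (pa H ⋅ Meta (street_monad X) S)) x) = carr x ∘ idc (cdom x).
  rewrite compf1; apply: heq_eq; apply: heq_trans (heq_idl _ (alg_over_zetaV _)) _.
  exact: castcod_heq.
pose MzV := @Build_CommaHom _ _ P (comma_map (s1_over (pa H ⋅ Meta (street_monad X) S)) x)
  x (idc (cdom x)) (alg_zetaV_cell (ccod x)) zc.
(* The right unit law makes this component of [theta] a left inverse of the image of [zeta], hence
   equal to the image of the inverse of [zeta]. *)
have h2 : heq (alg_theta_cell (comma_map (s1_over (street_eta S)) x))
    (fmap a (MzV : hom (c:=comma P) _ _)).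
  have e1 : fmap a (cell (street_two (pzeta H)) x) ∘ fmap a (cell (street_two (pzetaV H)) x)
     = idc _.
    rewrite -fmapM -fmap1; congr (fmap a _); apply: commahom_ext.
      exact: comp1f.
    exact: alg_zetaKV.
  have h3 : heq (fmap a (cell (street_two (pzetaV H)) x)) (fmap a (MzV : hom (c:=comma P) _ _)).
    apply: heq_fmap; apply: comma_heq => //=; try exact: heq_refl.
    by apply: commaob_eq => //=; apply: castcod_heq.
  apply: heq_trans h3.
  apply: heq_trans (heq_idl _ h).
  rewrite -!compA e1 compf1; apply: heq_sym.
  exact: heq_idr (heq_id_self hm).
(* The image of [v] starts at an object only propositionally equal to [comma_unit P (a x)]; [v'] is
   the same morphism with the domain of [u]. *)
have [v' hv'] : exists v' : hom (comma_unit P (a x))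
    (comma_map (s1_over (pa H ⋅ Meta (street_monad X) S)) x),
    heq v' (fmap (comma_map e) v).
  apply: heq_cast; apply: commaob_eq => //=.
  - by symmetry; exact: alg_ob.
  - by apply: heq_trans (castcod_heq _ _) _; apply: heq_idc; symmetry; exact: alg_ob.
  - apply: heq_trans (castcod_heq _ _) _; apply: heq_trans (castcod_heq _ _) _.
    by apply: heq_sym; apply: castcod_heq.
apply: heq_trans (heq_comp h2 (heq_fmap a (heq_sym hv'))) _.
rewrite -fmapM; apply: heq_fmap; apply: comma_heq => //=.
  apply: heq_trans (heq_sym u1).
  by apply: heq_trans (heq_idl _ (heq_refl _)) (heq_hdom hv').
rewrite u2; apply: heq_comp; [exact: heq_refl|exact: (heq_hcod hv')].
Qed.
(** Here [u] is the counit at [x], and this is the triangle identity at [a]: the left unit law, with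
    its component of [theta] replaced by [fmap a u] through [alg_theta_unit]. *)
Lemma alg_triangle (x : comma P) (u : hom (comma_unit P (a x)) x) :
  heq (hdom u) (idc (cdom x)) -> hcod u = alg_lift x ->
  fmap a u ∘ alg_zeta_cell (a x) = idc (a x).
Proof.
move=> u1 u2; apply: heq_eq.
have [m [hm h]] := alg_unit_l x.
apply: heq_trans h; rewrite compA.
apply: heq_comp; last exact: heq_refl.
apply: heq_trans (heq_sym (alg_theta_unit u1 u2)) _.
by apply: heq_sym; apply: heq_idr hm.
Qed.

(** The other triangle identity, on codomain components: [to_eta] at a unit object is an identity,
    so the lift there is the inverse of [zeta]. *)
Lemma alg_lift_unit (W : Y) : alg_lift (comma_unit P W) ∘ alg_zeta_cell W = idc W.
Proof.
have e1 : to_eta (comma_unit P W) = idc (comma_unit P W) by exact: commahom_ext.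
rewrite /alg_lift e1 fmap1 compf1; exact: alg_zetaVK.
Qed.

Lemma alg_cartesian (x : comma P) : is_cartesian P (alg_lift x).
Proof.
move=> W psi h e.
have [|h0 hh0] := heq_cast (A' := P W) (B' := cdom x) h (eq_refl _).
  exact: alg_ob.
have [|u [u1 u2]] := unit_hom_ex (x := x) (k := psi) (h := h0).
  rewrite -e; apply: heq_comp (heq_sym hh0).
  exact: alg_over_lift.
(* The transpose of the pair [u = (h, psi)]. *)
exists (fmap a u ∘ alg_zeta_cell W); split; first split.
- apply: heq_eq; rewrite fmapM.
  apply: heq_trans (heq_idr _ (alg_over_zeta W)) _.
  apply: heq_trans (alg_hom u) _.
  exact: heq_trans u1 hh0.
- by rewrite compA alg_lift_nat u2 -compA alg_lift_unit compf1.
- move=> xi [x1 x2].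
  (* Uniqueness: [v] is the counit at [x]. Any solution [xi] satisfies
     [u = v ∘ fmap (comma_unit P) xi], and naturality of [zeta] with the triangle identity recovers
     [xi]. *)
  have [|v [v1 v2]] := unit_hom_ex (x := x) (k := alg_lift x) (h := idc (cdom x)).
    by rewrite compf1; exact: alg_over_lift.
  have N : fmap a (fmap (comma_unit P) xi) ∘ alg_zeta_cell W = alg_zeta_cell (a x) ∘ xi.
    by symmetry; exact: (ntN alg_zeta_cell xi).
  suff -> : u = v ∘ fmap (comma_unit P) xi.
    by rewrite fmapM -compA N compA alg_triangle // comp1f.
  apply: commahom_ext => /=; last by rewrite u2 v2.
  apply: heq_eq; apply: heq_trans u1 _; apply: heq_trans hh0 _.
  by rewrite x1; apply: heq_sym; apply: heq_idl v1.
Qed.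

(** Follows from the compatibility of the inverse of [zeta] with the tangent structures and from
    naturality of [sa a] at [to_eta x]. It identifies [saV a x] as the comparison morphism
    [kappa]. *)
Lemma alg_lift_T (x : comma P) : fmap tT (alg_lift x) ∘ sa a x = alg_lift (T x).
Proof.
have N : fmap tT (alg_zetaV_cell (ccod x)) ∘
   (sa a (comma_unit P (ccod x)) ∘ fmap a (sa (comma_unit P) (ccod x)))
   = alg_zetaV_cell (T (ccod x)).
  by rewrite -[RHS]comp1f; exact: (ntT alg_zetaV_cell).
rewrite /alg_lift fmapM -compA -saN -N -!compA -fmapM.
congr (_ ∘ (_ ∘ fmap a _)); apply: commahom_ext => /=.
  by rewrite compA saKV comp1f.
by rewrite fmap1 comp1f.
Qed.

Lemma alg_tangent_fibration : is_strict P -> is_tangent_fibration (cleavage_of H).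
Proof.
move=> sP; split=> //.
- move=> A E f.
  exact: (conj (alg_over_lift (Build_CommaOb f)) (alg_cartesian (x := Build_CommaOb f))).
- move=> A E f l Tl; pose x : comma P := Build_CommaOb f.
  exists (saV a x); split; [|split].
  + have h : heq (fmap P (sa a x)) (idc (T A)).
      exact: heq_trans (heq_sym (heq_idl _ (sP (a x)))) (alg_sa x).
    apply: (heq_cancel_id (f := fmap P (sa a x))) => //.
    by rewrite -fmapM saVK fmap1; apply: heq_idc; exact: (proj1 (heq_dom h)).
  + rewrite -[lmap Tl]/(alg_lift (T x)) -alg_lift_T -compA saKV compf1.
    by [].
  + exists (sa a x); split; [exact: (saKV a x)|exact: (saVK a x)].
Qed.

Lemma heq_alg_lift (x y : comma P) : x = y -> heq (alg_lift x) (alg_lift y).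
Proof. by move=> ->; apply: heq_refl. Qed.

(* Naturality of [theta] along the map from [w] to the double unit on
   [ccod (ccod w)], where [theta] is known from [alg_theta_unit]. *)
Lemma alg_lift_theta (w : comma (comma_proj P)) :
  alg_lift (comma_mul P w) ∘ alg_theta_cell w
  = alg_lift (ccod w) ∘ alg_lift (comma_map e w).
Proof.
pose E := ccod (ccod w); pose y := comma_unit P E.
pose yy := comma_unit (comma_proj P) y.
have vc : fmap (comma_proj P) (to_eta (ccod w)) ∘ carr w
    = carr yy ∘ (carr (ccod w) ∘ carr w) by rewrite /= comp1f.
pose v : hom w yy := @Build_CommaHom _ _ (comma_proj P) w yy _ (to_eta (ccod w)) vc.
have N : alg_theta_cell yy ∘ fmap a (fmap (comma_map e) v)
  = fmap a (fmap (comma_mul P) v) ∘ alg_theta_cell w by exact: (ntN alg_theta_cell v).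
have [|u [u1 u2]] := unit_hom_ex (x := y) (k := alg_lift y) (h := idc (cdom y)).
  by rewrite compf1; exact: alg_over_lift.
(* At the double unit [yy], multiplication and the image of [a] both give unit objects, so
   [alg_theta_unit] at [y] applies with [u] as counit. *)
have e1 : comma_mul P yy = y.
  by apply: commaob_eq => //=; apply: eq_heq; rewrite comp1f.
have e2 : comma_map e yy = comma_unit P (a y).
  apply: commaob_eq => //=; first by symmetry; apply: (alg_ob y).
  apply: heq_trans (castcod_heq _ _) _; apply: heq_idc; symmetry; exact: (alg_ob y).
apply: heq_eq.
have -> : alg_lift (comma_mul P w) = alg_lift (comma_mul P yy) ∘ fmap a (fmap (comma_mul P) v).
  by rewrite alg_lift_nat /= comp1f.
rewrite -compA -N compA.
have h : heq (alg_lift (comma_mul P yy) ∘ alg_theta_cell yy)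
    (alg_lift y ∘ alg_lift (comma_map e yy)).
  apply: heq_trans (heq_comp (heq_alg_lift e1) (alg_theta_unit u1 u2)) _.
  rewrite alg_lift_nat u2; apply: heq_comp; first exact: heq_refl.
  by apply: heq_alg_lift.
apply: heq_trans (heq_comp h (heq_refl _)) _.
rewrite -compA alg_lift_nat compA; apply: heq_comp; last exact: heq_refl.
apply: eq_heq; rewrite [hcod _]/= alg_lift_nat /= comp1f.
by [].
Qed.

Lemma alg_over_saV (x : comma P) : is_strict P ->
  heq (fmap P (saV a x)) (idc (T (cdom x))).
Proof.
move=> sP.
have h : heq (fmap P (sa a x)) (idc (T (cdom x))).
  exact: heq_trans (heq_sym (heq_idl _ (sP (a x)))) (alg_sa x).
apply: (heq_cancel_id (f := fmap P (sa a x))) => //.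
by rewrite -fmapM saVK fmap1; apply: heq_idc; exact: (proj1 (heq_dom h)).
Qed.

(** The inverse of [zeta] is itself a chosen lift, hence determined by the cleavage. *)
Lemma alg_zetaVE (E : Y) : alg_zetaV_cell E = alg_lift (comma_unit P E).
Proof.
have e1 : to_eta (comma_unit P E) = idc (comma_unit P E) by exact: commahom_ext.
by rewrite /alg_lift e1 fmap1 compf1.
Qed.
End Algebra.

(** * Comparison of inverses and of morphisms into cartesian lifts *)

Lemma heq_inv (C : Cat) (A B A' B' : C) (f : hom A B) (f' : hom A' B')
    (g : hom B A) (g' : hom B' A') :
  f ∘ g = idc B -> g' ∘ f' = idc A' -> heq f f' -> heq g g'.
Proof.
move=> k k' h; have [eA eB] := heq_dom h; subst A' B'.
move: k'; rewrite -(heq_eq h) => k'; apply: eq_heq.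
by rewrite -[g]comp1f -k' -compA k compf1.
Qed.

Lemma cartesian_mono (C D : Cat) (P : Functor C D) (E' E W : C) (phi : hom E' E)
    (xi xi' : hom W E') : is_cartesian P phi ->
  phi ∘ xi = phi ∘ xi' -> heq (fmap P xi) (fmap P xi') -> xi = xi'.
Proof.
move=> c e /heq_eq e'.
have [|z [_ zu]] := c W (phi ∘ xi) (fmap P xi); first by rewrite fmapM.
by rewrite -(zu xi) // -(zu xi').
Qed.

(** The tool for uniqueness: it compares morphisms into the domains of two lifts that are equal only
    up to [heq]. *)
Lemma cartesian_heq (C D : Cat) (P : Functor C D) (E' E F' F W W' : C)
    (phi : hom E' E) (phi' : hom F' F) (xi : hom W E') (xi' : hom W' F') :
  is_cartesian P phi -> heq phi phi' -> heq (phi ∘ xi) (phi' ∘ xi') ->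
  heq (fmap P xi) (fmap P xi') -> heq xi xi'.
Proof.
move=> c h h1 h2; have [e e'] := heq_dom h; subst F' F.
have [eW _] := heq_dom h1; subst W'.
move: h1; rewrite -(heq_eq h) => /heq_eq h1.
apply: eq_heq; exact: cartesian_mono h1 h2.
Qed.

Lemma heq_lmap (C : Cat) (E : C) (l l' : Lift E) : l = l' -> heq (lmap l) (lmap l').
Proof. by move=> ->; apply: heq_refl. Qed.

Lemma pseudoalgebra_ext (K : TwoCat) (M : TwoMonad K) (A : K)
    (H H' : PseudoAlgebra M A) : pa H = pa H' ->
  heq2 (pzeta H) (pzeta H') -> heq2 (pzetaV H) (pzetaV H') ->
  heq2 (ptheta H) (ptheta H') -> heq2 (pthetaV H) (pthetaV H') -> H = H'.
Proof.
case: H H' => [p z zV t tV a1 a2 a3 a4 a5 a6 a7] [p' z' zV' t' tV' b1 b2 b3 b4 b5 b6 b7] /=.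
move=> e; subst p' => /heq2_eq ? /heq2_eq ? /heq2_eq ? /heq2_eq ?.
subst z' zV' t' tV'.
by rewrite (pirr _ a1 b1) (pirr _ a2 b2) (pirr _ a3 b3) (pirr _ a4 b4)
 (pirr _ a5 b5) (pirr _ a6 b6) (pirr _ a7 b7).
Qed.

(** * Uniqueness of the pseudoalgebra with a given cleavage *)

Section AlgebraUnique.
Variables (X Y : TangentCat) (P : Strong Y X).
Local Notation S := (@Build_SliceOb TngCat X Y P).
Variables H H' : PseudoAlgebra (street_monad X) S.
Hypothesis sP : is_strict P.
Hypothesis HH : cleavage_of H = cleavage_of H'.

Lemma alg_lift_uniq (x : comma P) : heq (alg_lift H x) (alg_lift H' x).
Proof.
exact: (heq_lmap (f_equal (fun c : Cleavage P => c (cdom x) (ccod x) (carr x)) HH)).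
Qed.

Lemma alg_lift_uniq_at (x x' : comma P) : x = x' -> heq (alg_lift H x) (alg_lift H' x').
Proof. by move=> ->; exact: alg_lift_uniq. Qed.

(** [saV] is compared rather than [sa] because it maps into the domain of the chosen lift of [T x];
    there its composite with the lift and its image under [P] are both known. *)
Lemma alg_saV_uniq (x : comma P) : heq (saV (alg_map H) x) (saV (alg_map H') x).
Proof.
have V (G : PseudoAlgebra (street_monad X) S) :
   alg_lift G (T x) ∘ saV (alg_map G) x = fmap tT (alg_lift G x).
  by rewrite -alg_lift_T -compA saKV compf1.
apply: (cartesian_heq (@alg_cartesian _ _ _ H (T x)) (alg_lift_uniq (T x))).
  rewrite !V; apply: heq_fmap; exact: alg_lift_uniq.
apply: heq_trans (alg_over_saV _ _ sP) _.
by apply: heq_sym; exact: alg_over_saV.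
Qed.

Lemma alg_pa_uniq : pa H = pa H'.
Proof.
apply: slice1_ext; apply: strong_ext => [x|x y u|x].
- exact: (proj1 (heq_dom (alg_lift_uniq x))).
- apply: (cartesian_heq (@alg_cartesian _ _ _ H y) (alg_lift_uniq y)).
    rewrite !alg_lift_nat; apply: heq_comp (alg_lift_uniq x); exact: heq_refl.
  apply: heq_trans (alg_hom _ _) _.
  by apply: heq_sym; exact: alg_hom.
- exact: heq_inv (saVK _ _) (saKV _ _) (alg_saV_uniq x).
Qed.

Lemma alg_zetaV_uniq (E : Y) : heq (alg_zetaV_cell H E) (alg_zetaV_cell H' E).
Proof. rewrite !alg_zetaVE; exact: alg_lift_uniq. Qed.

Lemma alg_theta_uniq (w : comma (comma_proj P)) : heq (alg_theta_cell H w) (alg_theta_cell H' w).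
Proof.
apply: (cartesian_heq (@alg_cartesian _ _ _ H (comma_mul P w)) (alg_lift_uniq (comma_mul P w))).
  (* The inner lift in [alg_lift_theta] is taken at an object that depends on the algebra map. *)
  have em : comma_map (s1_over (pa H)) w = comma_map (s1_over (pa H')) w.
    by rewrite alg_pa_uniq.
  by rewrite !alg_lift_theta; exact: (heq_comp (alg_lift_uniq (ccod w)) (alg_lift_uniq_at em)).
apply: heq_trans (alg_over_theta _ _) _.
by apply: heq_sym; exact: alg_over_theta.
Qed.

Lemma pseudoalgebra_unique : H = H'.
Proof.
have e := alg_pa_uniq.
have cellK (S1 S2 : Slice (X : TngCat)) (F G : one S1 S2) (t : two F G) (tV : two G F) E :
    vcomp tV t = id2 _ -> cell tV E ∘ cell t E = idc _.
  by move=> /(f_equal (fun t => cell t E)).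
apply: pseudoalgebra_ext => //; apply: slice_heq2; apply: trans_heq2; rewrite ?e //.
- move=> E; exact: heq_inv (alg_zetaVK H E) (alg_zetaKV H' E) (alg_zetaV_uniq E).
- exact: alg_zetaV_uniq.
- exact: alg_theta_uniq.
- move=> w; apply: heq_inv (alg_theta_uniq w).
    exact: (cellK _ _ _ _ (pthetaV H) (ptheta H) w (pthetaKV H)).
  exact: (cellK _ _ _ _ (ptheta H') (pthetaV H') w (pthetaVK H')).
Qed.
End AlgebraUnique.

(** * Strict tangent morphisms preserve the structure maps up to [heq] *)

Section StrictMaps.
Variables (X Y : TangentCat) (P : Strong Y X).
Hypothesis sP : is_strict P.

Lemma strict_saV (E : Y) : heq (saV P E) (idc (P (T E))).
Proof.
have h := heq_sym (sP E).
by apply: heq_sym; apply: heq_inv h; rewrite ?comp1f // saVK.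
Qed.

Lemma strict_T (E F : Y) (f : hom E F) :
  heq (fmap P (fmap tT f)) (fmap tT (fmap P f)).
Proof.
apply: heq_trans (heq_sym (heq_idl _ (sP F))) _; rewrite saN.
exact: heq_idr (sP E).
Qed.

Lemma strict_p (E : Y) : heq (fmap P (tp E)) (tp (P E)).
Proof. rewrite -(sp P); exact: heq_idr (sP E). Qed.

Lemma strict_z (E : Y) : heq (fmap P (tz E)) (tz (P E)).
Proof. rewrite -(sz P); apply: heq_sym; exact: heq_idl (sP E). Qed.

Lemma strict_TT (E : Y) : heq (fmap tT (sa P E) ∘ sa P (T E)) (idc (P (T (T E)))).
Proof.
apply: heq_trans (heq_idr _ (sP (T E))) _.
have h1 := heq_fmap tT (sP E); rewrite fmap1 in h1.
apply: heq_trans h1 _; apply: heq_idc.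
by have [_ ->] := heq_dom (heq_sym (sP (T E))).
Qed.

Lemma strict_l (E : Y) : heq (fmap P (tl E)) (tl (P E)).
Proof.
apply: heq_trans (heq_sym (heq_idl _ (strict_TT E))) _; rewrite sl.
exact: heq_idr (sP E).
Qed.

Lemma strict_c (E : Y) : heq (fmap P (tc E)) (tc (P E)).
Proof.
apply: heq_trans (heq_sym (heq_idl _ (strict_TT E))) _.
rewrite -sc -compA.
exact: heq_idr (strict_TT E).
Qed.
End StrictMaps.

(** * Transport of structure maps along equalities, and inverses of 2-cells *)

Lemma heq_comp1 (C : Cat) (A B D E : C) (g : hom D E) (f : hom B D) :
  heq g (idc A) -> heq f (idc A) -> heq (g ∘ f) (idc A).
Proof. by move=> hg hf; apply: heq_trans (heq_idl f hg) hf. Qed.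

Lemma heq_at (I : Type) (C : Cat) (f g : I -> C) (t : forall A, hom (f A) (g A))
  (A B : I) : A = B -> heq (t A) (t B).
Proof. by move=> ->; apply: heq_refl. Qed.

(** Here [n] plays the role of the comparison of twofold pullbacks under a strict morphism. The
    hypotheses force it to be an identity, as the two projections are jointly monic. *)
Lemma heq_ts (X : TangentCat) (A A' B : X) (n : hom B (tn 2 A')) : A' = A ->
  heq (tpr1 A' ∘ n) (tpr1 A) -> heq (tpr2 A' ∘ n) (tpr2 A) ->
  heq (ts A' ∘ n) (ts A).
Proof.
move=> eA; subst A' => h1 h2; have [eB _] := heq_dom h1; subst B.
suff -> : n = idc _ by rewrite compf1; apply: heq_refl.
apply: (nfold2_mono (ab_nfold (tadd (tlaws X) A))); rewrite compf1; exact: heq_eq.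
Qed.

(** Naturality and tangent compatibility pass to pointwise inverses, so only one cell of each
    inverse pair has to be checked. *)
Definition trans_inv (X Y : TangentCat) (F G : Strong X Y) (t : TangentTrans F G)
    (tV : forall A : X, hom (G A) (F A)) (tK : forall A, tV A ∘ t A = idc _)
    (tVK : forall A, t A ∘ tV A = idc _) : TangentTrans G F.
Proof.
refine (@Build_TangentTrans _ _ G F tV _ _).
- abstract (move=> A B f; apply: (iso_cancelL (tK B));
  by rewrite !compA tVK comp1f ntN -compA tVK compf1).
- abstract (move=> A;
  have e : fmap tT (tV A) ∘ fmap tT (t A) = idc _ by [rewrite -fmapM tK fmap1];
  symmetry; apply: (iso_moveL e);
  by rewrite compA ntT -compA tVK compf1).
Defined.

(** * From a tangent fibration to a pseudoalgebra: the reindexing functor *)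

Section Fibration.
Variables (X Y : TangentCat) (P : Strong Y X) (c : Cleavage P).
Hypothesis Hc : is_tangent_fibration c.
Local Notation S := (@Build_SliceOb TngCat X Y P).
Let sP := tf_strict Hc.

Definition lift_ob (x : comma P) : Y := ldom (c (carr x)).
Definition lift_map (x : comma P) : hom (lift_ob x) (ccod x) := lmap (c (carr x)).

Lemma lift_map_over (x : comma P) : heq (fmap P (lift_map x)) (carr x).
Proof. exact: (proj1 (tf_cloven Hc (carr x))). Qed.

Lemma lift_ob_over (x : comma P) : P (lift_ob x) = cdom x.
Proof. exact: (proj1 (heq_dom (lift_map_over x))). Qed.

Lemma lift_map_cartesian (x : comma P) : is_cartesian P (lift_map x).
Proof. exact: (proj2 (tf_cloven Hc (carr x))). Qed.

Lemma lift_map_mono (x : comma P) (W : Y) (xi xi' : hom W (lift_ob x)) :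
  lift_map x ∘ xi = lift_map x ∘ xi' -> heq (fmap P xi) (fmap P xi') -> xi = xi'.
Proof. by move=> e1 e2; exact: (cartesian_mono (@lift_map_cartesian x) e1 e2). Qed.

(** The cartesian property freed from casts: [h] ends in [cdom x] instead of [P (lift_ob x)], and
    its domain [B] need not be literally [P W]. Unique existence allows [factor] to extract a
    morphism. *)
Lemma factor_ex (x : comma P) (W : Y) (psi : hom W (ccod x)) (B : X)
    (h : hom B (cdom x)) : heq (fmap P psi) (carr x ∘ h) ->
  exists! xi : hom W (lift_ob x), heq (fmap P xi) h /\ lift_map x ∘ xi = psi.
Proof.
move=> e; have [eB _] := heq_dom e; subst B.
have [|h' hh'] := heq_cast h (eq_refl _) (B' := P (lift_ob x)).
  by symmetry; exact: lift_ob_over.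
have [|xi [[x1 x2] xu]] := @lift_map_cartesian x W psi h'.
  apply: heq_eq; apply: heq_trans (heq_sym e).
  exact: heq_comp (lift_map_over x) hh'.
exists xi; split; first by rewrite x1.
move=> z [z1 z2]; apply: lift_map_mono; first by rewrite x2 z2.
by rewrite x1; apply: heq_trans hh' (heq_sym z1).
Qed.

Definition factor (x : comma P) (W : Y) (psi : hom W (ccod x)) (B : X)
    (h : hom B (cdom x)) (e : heq (fmap P psi) (carr x ∘ h)) : hom W (lift_ob x) :=
  proj1_sig (constructive_definite_description _ (factor_ex e)).

Lemma factor_over (x : comma P) (W : Y) (psi : hom W (ccod x)) (B : X)
    (h : hom B (cdom x)) (e : heq (fmap P psi) (carr x ∘ h)) :
  heq (fmap P (factor e)) h.
Proof.
exact: (proj1 (proj2_sig (constructive_definite_description _ (factor_ex e)))).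
Qed.

Lemma factor_lift (x : comma P) (W : Y) (psi : hom W (ccod x)) (B : X)
    (h : hom B (cdom x)) (e : heq (fmap P psi) (carr x ∘ h)) :
  lift_map x ∘ factor e = psi.
Proof.
exact: (proj2 (proj2_sig (constructive_definite_description _ (factor_ex e)))).
Qed.

Lemma reindex_ok (x y : comma P) (u : hom x y) :
  heq (fmap P (hcod u ∘ lift_map x)) (carr y ∘ hdom u).
Proof.
rewrite fmapM -hcomm; apply: heq_comp (lift_map_over x); exact: heq_refl.
Qed.

Definition reindex (x y : comma P) (u : hom x y) : hom (lift_ob x) (lift_ob y) :=
  factor (reindex_ok u).

Lemma reindex_lift (x y : comma P) (u : hom x y) : lift_map y ∘ reindex u = hcod u ∘ lift_map x.
Proof. exact: factor_lift. Qed.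

Lemma reindex_over (x y : comma P) (u : hom x y) : heq (fmap P (reindex u)) (hdom u).
Proof. exact: factor_over. Qed.

Definition reindexF : Functor (comma P) Y.
Proof.
refine (@Build_Functor (comma P) Y lift_ob reindex _ _).
- abstract (move=> x; apply: lift_map_mono; [by rewrite reindex_lift comp1f compf1|];
  apply: heq_trans (reindex_over _) _; rewrite fmap1;
  apply: heq_idc; symmetry; exact: lift_ob_over).
- abstract (move=> x y z g f; apply: lift_map_mono;
  [by rewrite compA !reindex_lift -compA reindex_lift compA|];
  apply: heq_trans (reindex_over _) _; rewrite fmapM;
  by apply: heq_sym; apply: heq_comp; exact: reindex_over).
Defined.

(* Transposition for the adjunction of [comma_unit P] with [reindexF], by which [reindexF]
   preserves limits. *)
Definition transpose_dom (W : Y) (x : comma P) (xi : hom W (lift_ob x)) : hom (P W) (cdom x) :=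
  castcod (lift_ob_over x) (fmap P xi).

Lemma transpose_comm (W : Y) (x : comma P) (xi : hom W (lift_ob x)) :
  fmap P (lift_map x ∘ xi) ∘ carr (comma_unit P W) = carr x ∘ transpose_dom xi.
Proof.
rewrite /= compf1 fmapM; apply: heq_eq; apply: heq_comp (lift_map_over x) _.
by apply: heq_sym; exact: castcod_heq.
Qed.

Definition transpose (W : Y) (x : comma P) (xi : hom W (lift_ob x)) : hom (comma_unit P W) x :=
  @Build_CommaHom _ _ P (comma_unit P W) x (transpose_dom xi) (lift_map x ∘ xi) (transpose_comm xi).

Lemma transpose_inj (W : Y) (x : comma P) (xi xi' : hom W (lift_ob x)) :
  transpose xi = transpose xi' -> xi = xi'.
Proof.
move=> /chom[/= e1 e2]; apply: lift_map_mono => //.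
apply: heq_trans (heq_sym (castcod_heq (lift_ob_over x) _)) _.
rewrite -/(transpose_dom xi) e1; exact: castcod_heq.
Qed.

Lemma transpose_surj (W : Y) (x : comma P) (u : hom (comma_unit P W) x) :
  exists xi, transpose xi = u.
Proof.
have e : heq (fmap P (hcod u)) (carr x ∘ hdom u).
  by rewrite -hcomm /= compf1; apply: heq_refl.
exists (factor e); apply: commahom_ext => /=; last exact: factor_lift.
by apply: heq_eq; apply: heq_trans (castcod_heq _ _) (factor_over e).
Qed.

Lemma transpose_nat (W : Y) (x y : comma P) (u : hom x y) (xi : hom W (lift_ob x)) :
  transpose (reindex u ∘ xi) = u ∘ transpose xi.
Proof.
apply: commahom_ext => /=; last by rewrite compA reindex_lift compA.
apply: heq_eq; apply: heq_trans (castcod_heq _ _) _; rewrite fmapM.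
by apply: heq_comp (reindex_over u) _; apply: heq_sym; exact: castcod_heq.
Qed.

Lemma reindexF_wide_pullback (I : Type) (E B Q : comma P) (q : hom E B) (b : hom Q B)
    (pr : I -> hom Q E) : is_wide_pullback q b pr ->
  is_wide_pullback (fmap reindexF q) (fmap reindexF b) (fun i => fmap reindexF (pr i)).
Proof.
move=> [cm U]; split; first by move=> i; rewrite -fmapM cm.
move=> W w y wy.
(* The cone transposes to one with vertex [comma_unit P W] over the original diagram. *)
have [|u [[u1 u2] uu]] := U _ (transpose w) (fun i => transpose (y i)).
  by move=> i; rewrite -transpose_nat; congr transpose; exact: wy.
have [xi e] := transpose_surj u; subst u.
exists xi; split; first split.
- by apply: transpose_inj; rewrite transpose_nat.
- by move=> i; apply: transpose_inj; rewrite transpose_nat.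
- move=> z [z1 z2]; apply: transpose_inj; apply: uu; split.
    by rewrite -transpose_nat; congr transpose.
  by move=> i; rewrite -transpose_nat; congr transpose; exact: z2.
Qed.

Lemma reindexF_pullback (Q A B D : comma P) (f : hom A D) (g : hom B D)
    (pA : hom Q A) (pB : hom Q B) : is_pullback f g pA pB ->
  is_pullback (fmap reindexF f) (fmap reindexF g) (fmap reindexF pA) (fmap reindexF pB).
Proof.
move=> [cm U]; split; first by rewrite -!fmapM cm.
move=> W w y wy.
have [|u [[u1 u2] uu]] := U _ (transpose w) (transpose y).
  by rewrite -!transpose_nat; congr transpose; exact: wy.
have [xi e] := transpose_surj u; subst u.
exists xi; split; first split.
- by apply: transpose_inj; rewrite transpose_nat.
- by apply: transpose_inj; rewrite transpose_nat.
- by move=> z [z1 z2]; apply: transpose_inj; apply: uu; split;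
    rewrite -transpose_nat; congr transpose.
Qed.

(** * The inverse of [kappa] as structure map of reindexing *)

Lemma kappa_ok (x : comma P) :
  heq (fmap P (fmap tT (lift_map x))) (carr (T x) ∘ idc (T (cdom x))).
Proof.
rewrite compf1 /=; apply: heq_trans (strict_T sP (lift_map x)) _.
apply: heq_trans (heq_fmap tT (lift_map_over x)) _.
apply: heq_sym; exact: heq_idl (strict_saV sP _).
Qed.

Definition kappa (x : comma P) : hom (T (lift_ob x)) (lift_ob (T x)) :=
  factor (x := T x) (kappa_ok x).

Lemma kappa_lift (x : comma P) : lift_map (T x) ∘ kappa x = fmap tT (lift_map x).
Proof. exact: factor_lift. Qed.

Lemma kappa_over (x : comma P) : heq (fmap P (kappa x)) (idc (T (cdom x))).
Proof. exact: factor_over. Qed.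

(** [tf_kappa] provides some invertible comparison; it agrees with [kappa] because both have the
    same composite with the lift and lie over the identity. Stating uniqueness makes the inverse
    available as data. *)
Lemma kappa_inv_ex (x : comma P) :
  exists! g : hom (lift_ob (T x)) (T (lift_ob x)), g ∘ kappa x = idc _ /\ kappa x ∘ g = idc _.
Proof.
have [k [k1 [k2 [g [g1 g2]]]]] := tf_kappa Hc (carr x).
have e : kappa x = k.
  apply: lift_map_mono; first by rewrite kappa_lift; symmetry; exact: k2.
  by apply: heq_trans (kappa_over x) _; apply: heq_sym.
exists g; split; first by rewrite e.
move=> g' [_ g'2]; rewrite -[g]compf1 -g'2 compA e g1; exact: comp1f.
Qed.

Definition kappa_inv (x : comma P) : hom (lift_ob (T x)) (T (lift_ob x)) :=
  proj1_sig (constructive_definite_description _ (kappa_inv_ex x)).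

Lemma kappa_invK (x : comma P) : kappa_inv x ∘ kappa x = idc _.
Proof.
exact: (proj1 (proj2_sig (constructive_definite_description _ (kappa_inv_ex x)))).
Qed.

Lemma kappaK (x : comma P) : kappa x ∘ kappa_inv x = idc _.
Proof.
exact: (proj2 (proj2_sig (constructive_definite_description _ (kappa_inv_ex x)))).
Qed.

Lemma kappa_inv_lift (x : comma P) : fmap tT (lift_map x) ∘ kappa_inv x = lift_map (T x).
Proof. by rewrite -kappa_lift -compA kappaK compf1. Qed.

Lemma kappa_inv_over (x : comma P) : heq (fmap P (kappa_inv x)) (idc (T (cdom x))).
Proof.
apply: (heq_cancel_id (f := fmap P (kappa x))); last exact: kappa_over.
rewrite -fmapM kappa_invK fmap1; apply: heq_idc.
exact: (proj1 (heq_dom (kappa_over x))).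
Qed.

(** Composing with the isomorphism [kappa] turns [fmap tT (lift_map x)] into a chosen lift.
    Equations between maps into [T (lift_ob x)] can thus be checked after this map and after [P]. *)
Lemma T_lift_map_mono (x : comma P) (W : Y) (xi xi' : hom W (T (lift_ob x))) :
  fmap tT (lift_map x) ∘ xi = fmap tT (lift_map x) ∘ xi' ->
  heq (fmap P xi) (fmap P xi') -> xi = xi'.
Proof.
move=> e1 e2; apply: (iso_cancelL (kappa_invK x)); apply: lift_map_mono.
  by rewrite !compA kappa_lift.
by rewrite !fmapM; apply: heq_comp e2; apply: heq_refl.
Qed.

Lemma TT_lift_map_mono (x : comma P) (W : Y) (xi xi' : hom W (T (T (lift_ob x)))) :
  fmap tT (fmap tT (lift_map x)) ∘ xi = fmap tT (fmap tT (lift_map x)) ∘ xi' ->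
  heq (fmap P xi) (fmap P xi') -> xi = xi'.
Proof.
move=> e1 e2.
have k : fmap tT (kappa_inv x) ∘ fmap tT (kappa x) = idc _ by rewrite -fmapM kappa_invK fmap1.
apply: (iso_cancelL k); apply: T_lift_map_mono.
  by rewrite !compA -fmapM kappa_lift.
by rewrite !fmapM; apply: heq_comp e2; apply: heq_refl.
Qed.

Lemma kappa_invN (x y : comma P) (u : hom x y) :
  kappa_inv y ∘ fmap reindexF (fmap tT u) = fmap tT (fmap reindexF u) ∘ kappa_inv x.
Proof.
apply: T_lift_map_mono.
  rewrite compA kappa_inv_lift [fmap reindexF _]/= reindex_lift compA -fmapM.
  rewrite reindex_lift fmapM -compA.
  by rewrite kappa_inv_lift.
rewrite !fmapM; apply: heq_trans (heq_idl _ (kappa_inv_over y)) _.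
apply: heq_trans (reindex_over _) _; apply: heq_sym.
apply: heq_trans (heq_idr _ (kappa_inv_over x)) _.
apply: heq_trans (strict_T sP _) _.
exact: heq_fmap (reindex_over u).
Qed.

Lemma kappa_inv_bundle (x : comma P) :
  @bundle_morphism Y (bimg reindexF (tbundle x)) (tbundle (reindexF x))
    (idc (reindexF x)) (kappa_inv x).
Proof.
split=> /=.
- rewrite comp1f; apply: lift_map_mono.
    by rewrite compA -(tpN (tlaws Y)) -compA kappa_inv_lift reindex_lift.
  rewrite fmapM; apply: heq_trans (heq_idr _ (kappa_inv_over x)) _.
  apply: heq_trans (strict_p sP _) _.
  apply: heq_trans (heq_at (@tp X) (lift_ob_over x)) _.
  by apply: heq_sym; exact: reindex_over.
- rewrite compf1; apply: T_lift_map_mono.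
    by rewrite compA kappa_inv_lift reindex_lift -(tzN (tlaws Y)).
  rewrite fmapM; apply: heq_trans (heq_idl _ (kappa_inv_over x)) _.
  apply: heq_trans (reindex_over _) _; apply: heq_sym.
  apply: heq_trans (strict_z sP _) _.
  exact: (heq_at (f := fun A => A) (@tz X) (lift_ob_over x)).
- move=> m m1 m2; have nY := fun E => ab_nfold (tadd (tlaws Y) E).
  apply: T_lift_map_mono.
    (* [m'] is the map induced by [lift_map x] on twofold pullbacks, needed for naturality of the
       sum. *)
    have [|m' [/= m1' m2']] := nfold2_ex (nY (ccod x))
      (x := fmap tT (lift_map x) ∘ tpr1 (lift_ob x)) (y := fmap tT (lift_map x) ∘ tpr2 (lift_ob x)).
      rewrite /= !compA (tpN (tlaws Y)) -!compA.
      by rewrite !(proj1 (nY (lift_ob x) 2)).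
    rewrite !compA kappa_inv_lift reindex_lift -(tsN (tlaws Y) m1' m2') -compA.
    congr (_ ∘ _); apply: (nfold2_mono (nY (ccod x))) => /=.
      rewrite compA m1' -compA m1 compA kappa_inv_lift reindex_lift; by [].
    rewrite compA m2' -compA m2 compA kappa_inv_lift reindex_lift; by [].
  rewrite fmapM; apply: heq_trans (heq_idl _ (kappa_inv_over x)) _.
  apply: heq_trans (reindex_over _) _; apply: heq_sym.
  (* Over the base, [u] compares the image of the twofold pullback with the twofold pullback of the
     image; strictness of [P] reduces the claim to [heq_ts]. *)
  have [u [_ [_ [u1 [u2 u3]]]]] := strong_pair_di P (lift_ob x).
  apply: heq_trans (heq_sym (heq_idl _ (sP (lift_ob x)))) _.
  rewrite fmapM compA -u3 -compA.
  apply: heq_ts; first exact: lift_ob_over.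
  + rewrite compA u1 -compA -fmapM m1.
    apply: heq_trans (heq_idl _ (sP (lift_ob x))) _.
    rewrite fmapM; apply: heq_trans (heq_idl _ (kappa_inv_over x)) _.
    exact: reindex_over.
  + rewrite compA u2 -compA -fmapM m2.
    apply: heq_trans (heq_idl _ (sP (lift_ob x))) _.
    rewrite fmapM; apply: heq_trans (heq_idl _ (kappa_inv_over x)) _.
    exact: reindex_over.
Qed.

Lemma kappa_inv2_over (x : comma P) :
  heq (fmap P (fmap tT (kappa_inv x) ∘ kappa_inv (T x))) (idc (T (T (cdom x)))).
Proof.
rewrite fmapM; apply: heq_trans (kappa_inv_over (T x)).
apply: (heq_idl (A := T (T (cdom x)))).
apply: heq_trans (strict_T sP _) _.
by apply: heq_trans (heq_fmap tT (kappa_inv_over x)) _; rewrite fmap1; apply: heq_refl.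
Qed.

Lemma kappa_inv2_lift (x : comma P) :
  fmap tT (fmap tT (lift_map x)) ∘ (fmap tT (kappa_inv x) ∘ kappa_inv (T x)) = lift_map (T (T x)).
Proof. by rewrite compA -fmapM kappa_inv_lift kappa_inv_lift. Qed.

Lemma kappa_inv_l (x : comma P) : fmap tT (kappa_inv x) ∘ kappa_inv (T x) ∘ fmap reindexF (tl x)
  = tl (reindexF x) ∘ kappa_inv x.
Proof.
apply: TT_lift_map_mono.
  rewrite compA kappa_inv2_lift [fmap reindexF _]/= reindex_lift compA -(tlN (tlaws Y)) -compA.
  by rewrite kappa_inv_lift.
rewrite fmapM; apply: heq_trans (heq_idl _ (kappa_inv2_over x)) _.
apply: heq_trans (reindex_over _) _; apply: heq_sym.
rewrite fmapM; apply: heq_trans (heq_idr _ (kappa_inv_over x)) _.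
apply: heq_trans (strict_l sP _) _.
exact: (heq_at (f := fun A => T A) (g := fun A => T (T A)) (@tl X) (lift_ob_over x)).
Qed.

Lemma kappa_inv_c (x : comma P) : tc (reindexF x) ∘ fmap tT (kappa_inv x) ∘ kappa_inv (T x)
  = fmap tT (kappa_inv x) ∘ kappa_inv (T x) ∘ fmap reindexF (tc x).
Proof.
rewrite -(compA (tc (reindexF x))).
apply: TT_lift_map_mono.
  rewrite (compA _ (tc _)) -(tcN (tlaws Y)) -(compA (tc _)) kappa_inv2_lift.
  by rewrite (compA _ _ (fmap reindexF _)) kappa_inv2_lift [fmap reindexF _]/= reindex_lift.
rewrite !fmapM -fmapM.
apply: heq_trans (heq_idr _ (kappa_inv2_over x)) _; apply: heq_sym.
apply: heq_trans (heq_idl _ (kappa_inv2_over x)) _.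
apply: heq_trans (reindex_over _) _; apply: heq_sym.
apply: heq_trans (strict_c sP _) _.
exact: (heq_at (f := fun A => T (T A)) (g := fun A => T (T A)) (@tc X) (lift_ob_over x)).
Qed.

Lemma reindexF_nfold (x : comma P) : has_nfold (bimg reindexF (tbundle x)).
Proof. move=> n; exact: reindexF_wide_pullback (ab_nfold (tadd (tlaws (comma P)) x) n). Qed.

Lemma reindexF_vl (x : comma P) u : is_lift_pairing u ->
  is_pullback (fmap reindexF (fmap tT (tp x))) (fmap reindexF (tz x))
    (fmap reindexF (fmap tT (ts x) ∘ u)) (fmap reindexF (tp x ∘ tpr1 x)).
Proof. by move=> h; apply: reindexF_pullback; exact: (tvl (tlaws (comma P)) h). Qed.

Definition fib_action : Strong (comma P) Y :=
  @Build_Strong (comma P) Y reindexF kappa_inv kappa kappaK kappa_invK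
    kappa_invN kappa_inv_bundle kappa_inv_l kappa_inv_c reindexF_nfold reindexF_vl.

Lemma fib_action_over : strong_comp P fib_action = comma_proj P.
Proof.
apply: strong_ext => [x|x y u|x]; [exact: lift_ob_over|exact: reindex_over|].
exact: heq_trans (heq_idl _ (sP _)) (kappa_inv_over x).
Qed.

Definition fib_pa : one (street_monad X S) S :=
  @Build_SliceOne TngCat X (street_ob S) S fib_action fib_action_over.

(** * The unit and multiplication cells *)

(** The lifts of identities. This direction is built first because its naturality and tangent
    compatibility are instances of [reindex_lift] and [kappa_inv_lift]. *)
Definition fib_zetaV_cell : TangentTrans (strong_comp fib_action (comma_unit P)) (strong_id Y).
Proof.
refine (@Build_TangentTrans _ _ (strong_comp fib_action (comma_unit P)) (strong_id Y)
  (fun E => lift_map (comma_unit P E)) _ _).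
- abstract (by move=> E F f; exact: (reindex_lift (fmap (comma_unit P) f))).
- abstract (by move=> E /=; rewrite compA kappa_inv_lift reindex_lift).
Defined.

Lemma fib_zeta_ok (E : Y) : heq (fmap P (idc E)) (carr (comma_unit P E) ∘ idc (P E)).
Proof. by rewrite fmap1 compf1; apply: heq_refl. Qed.

Definition fib_zeta_at (E : Y) : hom E (lift_ob (comma_unit P E)) :=
  factor (x := comma_unit P E) (fib_zeta_ok E).

Lemma fib_zetaVK (E : Y) : lift_map (comma_unit P E) ∘ fib_zeta_at E = idc E.
Proof. exact: factor_lift. Qed.

Lemma fib_zeta_over (E : Y) : heq (fmap P (fib_zeta_at E)) (idc (P E)).
Proof. exact: factor_over. Qed.

Lemma fib_zetaKV (E : Y) : fib_zeta_at E ∘ lift_map (comma_unit P E) = idc _.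
Proof.
apply: lift_map_mono; first by rewrite compA fib_zetaVK comp1f compf1.
rewrite fmapM fmap1; apply: heq_trans (heq_idl _ (fib_zeta_over E)) _.
apply: heq_trans (lift_map_over _) _; apply: heq_idc.
by symmetry; exact: (lift_ob_over (comma_unit P E)).
Qed.

Definition fib_zeta_cell : TangentTrans (strong_id Y) (strong_comp fib_action (comma_unit P)) :=
  trans_inv (t := fib_zetaV_cell) fib_zetaKV fib_zetaVK.

Local Notation M := (comma_map fib_action_over).

(** A composite of two chosen lifts lies over the composite arrow, hence factors through the chosen
    lift of that composite; the factor is [theta]. *)
Lemma fib_theta_ok (w : comma (comma_proj P)) :
  heq (fmap P (lift_map (ccod w) ∘ lift_map (M w))) (carr (comma_mul P w) ∘ idc (cdom w)).
Proof.
rewrite compf1 fmapM; apply: heq_comp (lift_map_over _) _.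
apply: heq_trans (lift_map_over (M w)) _; exact: castcod_heq.
Qed.

Definition fib_theta_at (w : comma (comma_proj P)) :
    hom (lift_ob (M w)) (lift_ob (comma_mul P w)) :=
  factor (x := comma_mul P w) (fib_theta_ok w).

Lemma fib_theta_lift (w : comma (comma_proj P)) :
  lift_map (comma_mul P w) ∘ fib_theta_at w = lift_map (ccod w) ∘ lift_map (M w).
Proof. exact: factor_lift. Qed.

Lemma fib_theta_over (w : comma (comma_proj P)) :
  heq (fmap P (fib_theta_at w)) (idc (cdom w)).
Proof. exact: factor_over. Qed.

Lemma fib_split_ok (w : comma (comma_proj P)) :
  heq (fmap P (lift_map (comma_mul P w))) (carr (ccod w) ∘ carr w).
Proof. exact: (lift_map_over (comma_mul P w)). Qed.

Lemma fib_thetaV_ok (w : comma (comma_proj P)) :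
  heq (fmap P (factor (x := ccod w) (fib_split_ok w))) (carr (M w) ∘ idc (cdom w)).
Proof.
apply: heq_trans (factor_over _) _; rewrite compf1.
by apply: heq_sym; exact: castcod_heq.
Qed.

(** The lift of the composite arrow is factored through the two successive lifts, first through that
    of [ccod w] and then through that of [M w]. *)
Definition fib_thetaV_at (w : comma (comma_proj P)) :
    hom (lift_ob (comma_mul P w)) (lift_ob (M w)) :=
  factor (x := M w) (fib_thetaV_ok w).

Lemma fib_thetaV_lift (w : comma (comma_proj P)) :
  lift_map (ccod w) ∘ (lift_map (M w) ∘ fib_thetaV_at w) = lift_map (comma_mul P w).
Proof.
have -> : lift_map (M w) ∘ fib_thetaV_at w = factor (x := ccod w) (fib_split_ok w)
  by exact: factor_lift.
exact: factor_lift.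
Qed.

Lemma fib_thetaV_over (w : comma (comma_proj P)) :
  heq (fmap P (fib_thetaV_at w)) (idc (cdom w)).
Proof. exact: factor_over. Qed.

Lemma fib_thetaKV (w : comma (comma_proj P)) : fib_theta_at w ∘ fib_thetaV_at w = idc _.
Proof.
apply: lift_map_mono; first by rewrite compA fib_theta_lift -compA fib_thetaV_lift compf1.
rewrite fmapM fmap1; apply: heq_trans (heq_idl _ (fib_theta_over w)) _.
apply: heq_trans (fib_thetaV_over w) _; apply: heq_idc.
by symmetry; exact: (lift_ob_over (comma_mul P w)).
Qed.

Lemma fib_thetaVK (w : comma (comma_proj P)) : fib_thetaV_at w ∘ fib_theta_at w = idc _.
Proof.
have o : heq (fmap P (fib_thetaV_at w ∘ fib_theta_at w)) (idc (cdom w)).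
  rewrite fmapM; apply: heq_trans (heq_idl _ (fib_thetaV_over w)) _.
  exact: fib_theta_over.
have o' : heq (fmap P (fib_thetaV_at w ∘ fib_theta_at w)) (fmap P (idc (lift_ob (M w)))).
  apply: heq_trans o _; rewrite fmap1; apply: heq_idc.
  by symmetry; exact: (lift_ob_over (M w)).
apply: lift_map_mono => //; rewrite compf1.
apply: lift_map_mono; first by rewrite (compA (lift_map (M w)))
  (compA (lift_map (ccod w))) fib_thetaV_lift fib_theta_lift.
by rewrite fmapM; exact: heq_idr o.
Qed.

Lemma fib_thetaN (w w' : comma (comma_proj P)) (f : hom w w') :
  fib_theta_at w' ∘ fmap (strong_comp fib_action M) f
  = fmap (strong_comp fib_action (comma_mul P)) f ∘ fib_theta_at w.
Proof.
rewrite /=; apply: lift_map_mono.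
  rewrite compA fib_theta_lift -compA reindex_lift /= compA reindex_lift.
  by rewrite (compA (lift_map (comma_mul P w'))) reindex_lift /= -!compA fib_theta_lift.
rewrite !fmapM.
apply: heq_trans (heq_idl _ (fib_theta_over w')) _.
apply: heq_trans (reindex_over _) _; apply: heq_sym.
apply: heq_trans (heq_idr _ (fib_theta_over w)) _.
exact: reindex_over.
Qed.

Lemma fib_theta_T (w : comma (comma_proj P)) :
  fmap tT (fib_theta_at w) ∘ sa (strong_comp fib_action M) w
  = sa (strong_comp fib_action (comma_mul P)) w ∘ fib_theta_at (T w).
Proof.
(* The structure map of each composite combines a [kappa_inv] with a reindexing. [e1] to [e3]
   compute what it becomes after [T] of a lift. *)
have e1 : hcod (sa M w) = kappa_inv (ccod w).
  have e0 : fmap reindexF (idc (T (ccod w))) = idc _ by exact: fmap1.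
  by rewrite /= -[RHS]compf1; congr (_ ∘ _); exact: e0.
have e2 : fmap tT (lift_map (M w)) ∘ sa (strong_comp fib_action M) w
    = kappa_inv (ccod w) ∘ lift_map (M (T w)).
  by rewrite /= compA kappa_inv_lift -e1; exact: (reindex_lift (sa M w)).
have e3 : fmap tT (lift_map (comma_mul P w)) ∘ sa (strong_comp fib_action (comma_mul P)) w
    = lift_map (comma_mul P (T w)).
  rewrite /= compA kappa_inv_lift -[RHS]comp1f; rewrite -(comp1f (idc _)).
  exact: (reindex_lift (sa (comma_mul P) w)).
apply: T_lift_map_mono.
  rewrite compA -fmapM fib_theta_lift fmapM -compA e2 compA kappa_inv_lift.
  by rewrite compA e3 fib_theta_lift.
rewrite !fmapM.
have o1 : heq (fmap P (fmap tT (fib_theta_at w))) (idc (T (cdom w))).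
  apply: heq_trans (strict_T sP _) _.
  by apply: heq_trans (heq_fmap tT (fib_theta_over w)) _; rewrite fmap1; apply: heq_refl.
have o2 : heq (fmap P (fmap fib_action (sa M w))) (idc (T (cdom w))).
  exact: (reindex_over (sa M w)).
have o3 : heq (fmap P (fmap fib_action (sa (comma_mul P) w))) (idc (T (cdom w))).
  exact: (reindex_over (sa (comma_mul P) w)).
apply: heq_trans (heq_comp1 o1 (heq_comp1 (kappa_inv_over _) o2)) _.
apply: heq_sym; apply: heq_comp1 (fib_theta_over (T w)).
exact: heq_comp1 (kappa_inv_over _) o3.
Qed.

Definition fib_theta_cell :
  TangentTrans (strong_comp fib_action M) (strong_comp fib_action (comma_mul P)) :=
  @Build_TangentTrans _ _ (strong_comp fib_action M) (strong_comp fib_action (comma_mul P))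
  fib_theta_at fib_thetaN fib_theta_T.

Definition fib_thetaV_cell :
  TangentTrans (strong_comp fib_action (comma_mul P)) (strong_comp fib_action M) :=
  trans_inv (t := fib_theta_cell) fib_thetaVK fib_thetaKV.

(** * The pseudoalgebra and its coherence laws *)

Local Notation SM := (street_monad X).
Let LS : Slice (X : TngCat) := S.

Definition fib_zeta : two (id1 LS) (fib_pa ⋅ Meta SM LS).
Proof.
refine (@Build_SliceTwo TngCat X S S (id1 LS) (fib_pa ⋅ Meta SM LS) fib_zeta_cell _).
abstract (apply: trans_heq2; [exact: (s1_over (id1 LS))|exact: (s1_over (fib_pa ⋅ Meta SM LS))|
  exact: fib_zeta_over]).
Defined.

Definition fib_zetaV : two (fib_pa ⋅ Meta SM LS) (id1 LS).
Proof.
refine (@Build_SliceTwo TngCat X S S (fib_pa ⋅ Meta SM LS) (id1 LS) fib_zetaV_cell _).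
abstract (apply: trans_heq2; [exact: (s1_over (fib_pa ⋅ Meta SM LS))|exact: (s1_over (id1 LS))|
  by move=> E; exact: (lift_map_over (comma_unit P E))]).
Defined.

Definition fib_theta : two (fib_pa ⋅ M1 SM fib_pa) (fib_pa ⋅ Mgamma SM LS).
Proof.
refine (@Build_SliceTwo TngCat X (street_ob (street_ob S)) S (fib_pa ⋅ M1 SM fib_pa)
  (fib_pa ⋅ Mgamma SM LS) fib_theta_cell _).
abstract (apply: trans_heq2; [exact: (s1_over (fib_pa ⋅ M1 SM fib_pa))
  |exact: (s1_over (fib_pa ⋅ Mgamma SM LS))|
  exact: fib_theta_over]).
Defined.

Definition fib_thetaV : two (fib_pa ⋅ Mgamma SM LS) (fib_pa ⋅ M1 SM fib_pa).
Proof.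
refine (@Build_SliceTwo TngCat X (street_ob (street_ob S)) S (fib_pa ⋅ Mgamma SM LS)
  (fib_pa ⋅ M1 SM fib_pa) fib_thetaV_cell _).
abstract (apply: trans_heq2; [exact: (s1_over (fib_pa ⋅ Mgamma SM LS))
  |exact: (s1_over (fib_pa ⋅ M1 SM fib_pa))|
  exact: fib_thetaV_over]).
Defined.

Lemma heq_lift_map (x y : comma P) : x = y -> heq (lift_map x) (lift_map y).
Proof. by move=> ->; apply: heq_refl. Qed.

(** Reduces each coherence law to two checks, after the lift and after [P]; under [P] every factor
    becomes an identity. *)
Lemma lift_map_heq (x y : comma P) (W W' : Y) (xi : hom W (lift_ob x)) (xi' : hom W' (lift_ob y)) :
  x = y -> heq (lift_map x ∘ xi) (lift_map y ∘ xi') -> heq (fmap P xi) (fmap P xi') ->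
  heq xi xi'.
Proof. by move=> /heq_lift_map e; exact: (cartesian_heq (@lift_map_cartesian x) e). Qed.

Lemma fib_unit_l : heq2 (vcomp (wr fib_theta (Meta SM (SM LS)))
      (vcomp (id2_of (pa_eq_unit_l fib_pa)) (wr fib_zeta fib_pa))) (id2 fib_pa).
Proof.
apply: slice_heq2; apply: trans_heq2.
- exact: (f_equal (fun F => s1 F) (comp1Il fib_pa)).
- by rewrite -comp1A Munit_l comp1Ir.
move=> x; pose yy := comma_unit (comma_proj P) x.
pose m := cell (id2_of (pa_eq_unit_l fib_pa)) x.
have hm : heq m (idc (lift_ob (comma_unit P (lift_ob x)))) := id2_of_heq (pa_eq_unit_l fib_pa) x.
change (heq (fib_theta_at yy ∘ (m ∘ fib_zeta_at (lift_ob x))) (idc (lift_ob x))).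
(* These equalities let the lifts at [yy] be replaced by the lift of [x] and the lift of an
   identity, which cancels [zeta]. *)
have e1 : comma_mul P yy = x.
  by apply: commaob_eq => //=; apply: eq_heq; rewrite compf1.
have e2 : M yy = comma_unit P (lift_ob x).
  apply: commaob_eq => //=; first by symmetry; exact: lift_ob_over.
  by apply: heq_trans (castcod_heq _ _) _; apply: heq_idc; symmetry; exact: lift_ob_over.
apply: (lift_map_heq e1).
  rewrite compA fib_theta_lift compf1 -compA.
  have h : heq (lift_map (M yy) ∘ (m ∘ fib_zeta_at (lift_ob x))) (idc (lift_ob x)).
    rewrite -fib_zetaVK; apply: heq_comp; first exact: heq_lift_map.
    exact: heq_idl hm.
  exact: heq_idr h.
rewrite !fmapM fmap1.
have h2 : heq (idc (P (lift_ob x))) (idc (cdom x)) by apply: heq_idc; exact: lift_ob_over.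
apply: heq_trans (heq_sym h2).
apply: heq_comp1; first exact: (fib_theta_over yy).
apply: heq_comp1; last exact: heq_trans (fib_zeta_over _) h2.
apply: heq_trans (heq_fmap P hm) _; rewrite fmap1.
by apply: heq_trans h2; apply: heq_idc; exact: (lift_ob_over (comma_unit P (lift_ob x))).
Qed.

Lemma fib_unit_r : heq2 (vcomp (wr fib_theta (M1 SM (Meta SM LS)))
      (vcomp (id2_of (pa_eq_unit_r fib_pa)) (wl fib_pa (M2 SM fib_zeta)))) (id2 fib_pa).
Proof.
apply: slice_heq2; apply: trans_heq2.
- by rewrite M1_id comp1Ir.
- by rewrite -comp1A Munit_r comp1Ir.
move=> x; pose yy := comma_map (s1_over (street_eta S)) x.
pose m := cell (id2_of (pa_eq_unit_r fib_pa)) x.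
pose z := cell (street_two fib_zeta) x.
pose x1 := comma_map (s1_over (fib_pa ⋅ Meta SM LS)) x.
have hm : heq m (idc (lift_ob x1)) := id2_of_heq (pa_eq_unit_r fib_pa) x.
change (heq (fib_theta_at yy ∘ (m ∘ reindex z)) (idc (lift_ob x))).
have e1 : comma_mul P yy = x.
  apply: commaob_eq => //=.
  by apply: heq_trans (heq_idl _ (heq_refl _)) (castcod_heq _ _).
have e2 : M yy = x1.
  apply: commaob_eq => //=.
  apply: heq_trans (castcod_heq _ _) _; apply: heq_trans (castcod_heq _ _) _.
  by apply: heq_sym; exact: castcod_heq.
have e3 : comma_map (s1_over (id1 LS)) x = x.
  by apply: commaob_eq => //=; exact: castcod_heq.
apply: (lift_map_heq e1).
  rewrite compA fib_theta_lift compf1 -compA.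
  (* Naturality of lifts along [z], whose codomain component is [zeta], moves [zeta] past the lift
     of [x]. *)
  have h : heq (lift_map (M yy) ∘ (m ∘ reindex z)) (fib_zeta_at (ccod x) ∘ lift_map x).
    apply: heq_trans (heq_comp (heq_lift_map e2) (heq_idl _ hm)) _.
    rewrite reindex_lift; apply: heq_comp; first exact: heq_refl.
    exact: heq_lift_map.
  apply: heq_trans (heq_comp (heq_refl _) h) _.
  by rewrite compA fib_zetaVK comp1f; apply: heq_refl.
rewrite !fmapM fmap1.
have h2 : heq (idc (P (lift_ob x))) (idc (cdom x)) by apply: heq_idc; exact: lift_ob_over.
apply: heq_trans (heq_sym h2).
apply: heq_comp1; first exact: (fib_theta_over yy).
apply: heq_comp1; last exact: (reindex_over z).
apply: heq_trans (heq_fmap P hm) _; rewrite fmap1.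
by apply: heq_idc; exact: (lift_ob_over x1).
Qed.

Lemma fib_assoc : heq2 (vcomp (wr fib_theta (Mgamma SM (SM LS)))
           (vcomp (id2_of (pa_eq_assoc_l fib_pa)) (wr fib_theta (M1 SM (M1 SM fib_pa)))))
         (vcomp (wr fib_theta (M1 SM (Mgamma SM LS)))
           (vcomp (id2_of (pa_eq_assoc_r fib_pa)) (wl fib_pa (M2 SM fib_theta)))).
Proof.
apply: slice_heq2; apply: trans_heq2.
- by rewrite M1_comp comp1A.
- by rewrite -!comp1A Massoc.
move=> t.
(* An object [t] is a chain of three arrows ending in some [P E]. [w1] composes the first two, [w2]
   composes the last two, and [w3] replaces [E] by its reindexing along the last. *)
pose w1 : comma (comma_proj P) := comma_mul (comma_proj P) t.
pose w2 : comma (comma_proj P) := comma_map (s1_over (street_gamma S)) t.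
pose w3 : comma (comma_proj P) := comma_map (s1_over (street_one fib_pa)) t.
pose m := cell (id2_of (pa_eq_assoc_l fib_pa)) t.
pose n := cell (id2_of (pa_eq_assoc_r fib_pa)) t.
pose z := cell (street_two fib_theta) t.
pose x1 := comma_mul P w3.
pose x2 := comma_map (s1_over (fib_pa ⋅ Mgamma SM LS)) t.
pose x3 := comma_map (s1_over (fib_pa ⋅ M1 SM fib_pa)) t.
have hm : heq m (idc (lift_ob x1)) := id2_of_heq (pa_eq_assoc_l fib_pa) t.
have hn : heq n (idc (lift_ob x2)) := id2_of_heq (pa_eq_assoc_r fib_pa) t.
change (heq (fib_theta_at w1 ∘ (m ∘ fib_theta_at w3)) (fib_theta_at w2 ∘ (n ∘ reindex z))).
have cc A (B B' B'' : X) (q : B = B') (q' : B' = B'') (q2 : B = B'') (f : hom A B) :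
    heq (castcod q' (castcod q f)) (castcod q2 f).
  apply: heq_trans (castcod_heq _ _) _; apply: heq_trans (castcod_heq _ _) _.
  by apply: heq_sym; exact: castcod_heq.
have e1 : comma_mul P w1 = comma_mul P w2.
  apply: commaob_eq => //=; rewrite compA; apply: heq_comp; first exact: heq_refl.
  by apply: heq_sym; exact: castcod_heq.
have e2 : M w1 = x1.
  apply: commaob_eq => //=; apply: heq_trans (castcod_heq _ _) _; apply: heq_sym.
  by apply: heq_comp; exact: castcod_heq.
have e3 : M w2 = x2 by apply: commaob_eq => //=; exact: cc.
have e4 : M w3 = x3 by apply: commaob_eq => //=; exact: cc.
apply: (lift_map_heq e1).
  (* After the lift, both sides become the composite of the three successive chosen lifts along
     [t]. *)
  rewrite (compA (lift_map (comma_mul P w1))) (compA (lift_map (comma_mul P w2))).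
  rewrite !fib_theta_lift -(compA (lift_map (ccod w1))) -(compA (lift_map (ccod w2))).
  have h1 : heq (lift_map (M w1) ∘ (m ∘ fib_theta_at w3)) (lift_map (ccod w3) ∘ lift_map (M w3)).
    rewrite -fib_theta_lift; apply: heq_comp; first exact: heq_lift_map.
    exact: heq_idl hm.
  have h2 : heq (lift_map (M w2) ∘ (n ∘ reindex z)) (fib_theta_at (ccod t) ∘ lift_map (M w3)).
    apply: heq_trans (heq_comp (heq_lift_map e3) (heq_idl _ hn)) _.
    rewrite reindex_lift; apply: heq_comp; first exact: heq_refl.
    by apply: heq_lift_map.
  apply: heq_trans (heq_comp (heq_refl _) h1) _; apply: heq_sym.
  apply: heq_trans (heq_comp (heq_refl _) h2) _.
  rewrite !compA; apply: heq_comp; last exact: heq_refl.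
  apply: eq_heq; exact: fib_theta_lift.
rewrite !fmapM.
apply: (heq_trans (g := idc (cdom t))).
  apply: heq_comp1; first exact: (fib_theta_over w1).
  apply: heq_comp1; last exact: (fib_theta_over w3).
  apply: heq_trans (heq_fmap P hm) _; rewrite fmap1.
  by apply: heq_idc; exact: (lift_ob_over x1).
apply: heq_sym; apply: heq_comp1; first exact: (fib_theta_over w2).
apply: heq_comp1; last exact: (reindex_over z).
apply: heq_trans (heq_fmap P hn) _; rewrite fmap1.
by apply: heq_idc; exact: (lift_ob_over x2).
Qed.

Definition fib_algebra : PseudoAlgebra SM LS.
Proof.
refine (@Build_PseudoAlgebra (Slice (X : TngCat)) SM LS fib_pa
  fib_zeta fib_zetaV fib_theta fib_thetaV
  _ _ _ _ fib_unit_l fib_unit_r fib_assoc).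
- abstract (apply: slice2_ext; apply: trans_ext; exact: fib_zetaVK).
- abstract (apply: slice2_ext; apply: trans_ext; exact: fib_zetaKV).
- abstract (apply: slice2_ext; apply: trans_ext; exact: fib_thetaVK).
- abstract (apply: slice2_ext; apply: trans_ext; exact: fib_thetaKV).
Defined.

(** The recovered lift of [f] is the lift of an identity after reindexing along [to_unit f], which
    is the original lift because [to_unit f] has identity codomain component. *)
Lemma fib_algebra_cleavage : cleavage_of fib_algebra = c.
Proof.
apply: functional_extensionality_dep => A; apply: functional_extensionality_dep => E.
apply: functional_extensionality_dep => f; pose x : comma P := Build_CommaOb f.
have h : lift_map (comma_unit P E) ∘ reindex (@to_unit X S A E f) = lift_map x.
  by rewrite reindex_lift; exact: comp1f.
exact: (f_equal (@Build_Lift Y E (lift_ob x)) h).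
Qed.
End Fibration.

(** * The correspondence *)

(** Together the two halves say that, over a strict [S], [cleavage_of] is a bijection from
    pseudoalgebra structures to cleavages that form a tangent fibration; in the second half
    strictness comes from [tf_strict]. *)
Theorem theorem3p29 (X : TangentCat) (S : Slice (X : TngCat)) :
  (forall H : PseudoAlgebra (street_monad X) S,
     is_strict (smap S : Strong (sob S) X) ->
     is_tangent_fibration (cleavage_of H)) /\
  (forall c : Cleavage (smap S : Strong (sob S) X),
     is_tangent_fibration c ->
     exists! H : PseudoAlgebra (street_monad X) S, cleavage_of H = c).
Proof.
case: S => Y P; split=> [H|c Hc]; first exact: alg_tangent_fibration.
exists (fib_algebra Hc); split; first exact: fib_algebra_cleavage.
move=> H e; apply: (pseudoalgebra_unique (tf_strict Hc)).
by rewrite fib_algebra_cleavage; symmetry.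
Qed.
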